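(* Let $m\in\{2,3\}$ and consider the autonomous system $$\dot p=v,\qquad \dot v=-v-\overline BD_ze-\overline S_1D_z(\mu-\hat\mu),\qquad \dot z=\overline B^Tv,\qquad \dot e=2D_z^T\overline B^Tv,\qquad \dot{\hat\mu}=\hat u,$$ with non-zero mismatches $\mu$ and a desired infinitesimally and minimally rigid formation shape $\mathcal Z$. Consider also the following distributed control action for the estimator $\hat\mu$: $$\hat u=-D_z^T\overline S_1^Tv,$$ where the estimating agents are chosen arbitrarily. Then the equilibrium points $(p^*,v^*,z^*,e^*,\hat\mu^* )$ of this system are asymptotically stable, where $v^*=\mathbf 0$ and the steady-state deformation of the shape satisfies $$\|e^*\|^2\le 2\|\mu-\hat\mu(0)\|^2+2\|v(0)\|^2+\|e(0)\|^2 .$$ Moreover, for the particular cases of triangles and tetrahedrons, the equilibrium has $e^*=\mathbf 0$, i.e. $\hat\mu^*=\mu$ and $z^*\in\mathcal Z$.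
   Context: Notation. $n\ge2$ agents have positions $p_i\in\mathbb R^m$ and velocities $v_i\in\mathbb R^m$; $p,v\in\mathbb R^{mn}$ are the stacked vectors. For a matrix $A$, $\overline A=A\otimes I_m$ (Kronecker product). For a stacked vector $x=[x_1^T\dots x_k^T]^T$ with blocks $x_i\in\mathbb R^m$, $D_x=\operatorname{diag}\{x_i\}$ is the $km\times k$ block-diagonal matrix with the column blocks $x_i$. $\|\cdot\|$ is the Euclidean norm. Graph. The sensing topology is an undirected graph $\mathbb G=(\mathcal V,\mathcal E)$, $\mathcal V=\{1,\dots,n\}$, whose edges are ordered and written $\mathcal E_k=(\mathcal E_k^{\rm tail},\mathcal E_k^{\rm head})$. The incidence matrix $B\in\mathbb R^{|\mathcal V|\times|\mathcal E|}$ has entries $b_{ik}=1$ if $i=\mathcal E_k^{\rm tail}$, $b_{ik}=-1$ if $i=\mathcal E_k^{\rm head}$, and $0$ otherwise. $S_1$ is obtained from $B$ by setting its $-1$ entries to $0$. The estimating agent of edge $\mathcal E_k$ is $\mathcal E_k^{\rm tail}$; that the estimating agents are chosen arbitrarily means that for each edge the order of its two agents (tail and head) can be chosen arbitrarily. The vector $z=\overline B^Tp$ stacks the relative positions $z_k=p_i-p_j$ for $\mathcal E_k=(i,j)$. Rigidity. The rigidity matrix is $R(z)=D_z^T\overline B^T$. A framework $(\mathbb G,p)$ is infinitesimally rigid if $\operatorname{rank}R(z)=2n-3$ (for $m=2$) or $3n-6$ (for $m=3$); it is infinitesimally and minimally rigid if in addition $|\mathcal E|=2n-3$ or $|\mathcal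 E|=3n-6$, respectively. Given a stacked vector of desired relative positions $z^{\rm des}$, the desired shape is $\mathcal Z=\{(I_{|\mathcal E|}\otimes \mathcal R)z^{\rm des}\}$, where $\mathcal R$ ranges over all rotation matrices in $\mathbb R^m$, and $d_k=\|z_k^{\rm des}\|$ are the desired inter-agent distances. The error signal $e\in\mathbb R^{|\mathcal E|}$ is the stacked vector of $e_k=\|z_k\|^2-d_k^2$. Triangles are formations with $m=2$, $n=3$ and complete graph; tetrahedrons are formations with $m=3$, $n=4$ and complete graph. Mismatches and estimator. $\mu\in\mathbb R^{|\mathcal E|}$ is the stacked vector of constant mismatches $\mu_k$; $\mu_k$ is the discrepancy between the squared desired distances used by the two agents of edge $\mathcal E_k$ (the head agent uses $d_k^2$, the tail agent $d_k^2-\mu_k$). $\hat\mu\in\mathbb R^{|\mathcal E|}$ is the estimator state and $\hat u$ is the estimator input. ''Distributed'' means that each estimating agent uses only local information, namely the relative position $z_k$ of the edge and its own velocity.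
   Formalization: Coincident agents give unstable equilibria with nonzero e, and translations prevent any single point attracting. So stability and e*=0 are claimed only for equilibria and starts near the desired shape with v near 0 and the estimate near mu, and attraction means convergence to some equilibrium. *)

(* Defs.v *)
From mathcomp Require Import all_boot all_order all_algebra.
From mathcomp Require Import all_classical all_reals all_analysis.
From mathcomp Require Import mxtens.

Set Implicit Arguments.
Unset Strict Implicit.
Unset Printing Implicit Defensive.

Import Order.TTheory GRing.Theory Num.Theory.
Import numFieldNormedType.Exports.
Local Open Scope classical_set_scope.
Local Open Scope ring_scope.

(* An undirected simple graph on the agents 'I_n, with its ne edges ordered by
   'I_ne and each edge given an ordering (tail, head) of its two agents.  The
   choice of the ordering is free: the tail is the estimating agent. *)
Record sensing_graph (n ne : nat) := SensingGraph {
  etail : 'I_ne -> 'I_n;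
  ehead : 'I_ne -> 'I_n;
  etail_neq_ehead : forall k, etail k != ehead k;
  edge_inj : forall k l,
    [set etail k; ehead k]%SET = [set etail l; ehead l]%SET -> k = l
}.

Definition complete_graph n ne (G : sensing_graph n ne) : Prop :=
  forall i j : 'I_n, i != j ->
    exists k, [set etail G k; ehead G k]%SET = [set i; j]%SET.

Section Matrices.
Variable R : realType.

Definition enorm k (x : 'cV[R]_k) : R := Num.sqrt (\sum_i x i 0 ^+ 2).

Definition kron_id (m a b : nat) (A : 'M[R]_(a, b)) : 'M[R]_(a * m, b * m) :=
  tensmx A (1%:M : 'M[R]_m).

(* A stacked vector in R^(k m) has its i-th block at the positions
   mxtens_index (i, _), which is the convention of tensmx. *)
Definition block m k (x : 'cV[R]_(k * m)) (i : 'I_k) : 'cV[R]_m :=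
  \col_a x (mxtens_index (i, a)) 0.

Definition blockdiag m k (x : 'cV[R]_(k * m)) : 'M[R]_(k * m, k) :=
  \matrix_(r, j) (if (mxtens_unindex r).1 == j then x r 0 else 0).

Definition rotation m (Q : 'M[R]_m) : Prop := Q *m Q^T = 1%:M /\ \det Q = 1.

End Matrices.

Section Formation.
Variables (R : realType) (m n ne : nat) (G : sensing_graph n ne).

Definition incidence : 'M[R]_(n, ne) :=
  \matrix_(i, k) (if i == etail G k then 1 else if i == ehead G k then -1 else 0).

Definition incidence_tail : 'M[R]_(n, ne) :=
  \matrix_(i, k) (if incidence i k == -1 then 0 else incidence i k).

Definition relpos (p : 'cV[R]_(n * m)) : 'cV[R]_(ne * m) :=
  (kron_id m incidence)^T *m p.

Definition rigidity_matrix (z : 'cV[R]_(ne * m)) : 'M[R]_(ne, n * m) :=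
  (blockdiag z)^T *m (kron_id m incidence)^T.

Definition inf_rigid (p : 'cV[R]_(n * m)) : Prop :=
  (m = 2%N /\ \rank (rigidity_matrix (relpos p)) = (2 * n - 3)%N) \/
  (m = 3%N /\ \rank (rigidity_matrix (relpos p)) = (3 * n - 6)%N).

Definition inf_min_rigid (p : 'cV[R]_(n * m)) : Prop :=
  inf_rigid p /\
  ((m = 2%N /\ ne = (2 * n - 3)%N) \/ (m = 3%N /\ ne = (3 * n - 6)%N)).

Definition triangle : Prop := [/\ m = 2%N, n = 3%N & complete_graph G].

Definition tetrahedron : Prop := [/\ m = 3%N, n = 4%N & complete_graph G].

Definition desired_shape (zdes : 'cV[R]_(ne * m)) : set 'cV[R]_(ne * m) :=
  [set z | exists2 Q : 'M[R]_m, rotation Q & z = tensmx (1%:M : 'M[R]_ne) Q *m zdes].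

Definition error (zdes z : 'cV[R]_(ne * m)) : 'cV[R]_ne :=
  \col_k (enorm (block z k) ^+ 2 - enorm (block zdes k) ^+ 2).

Record state := State {
  pos : 'cV[R]_(n * m);
  vel : 'cV[R]_(n * m);
  rpos : 'cV[R]_(ne * m);
  err : 'cV[R]_ne;
  est : 'cV[R]_ne
}.

Definition sdist (x y : state) : R :=
  Num.sqrt (enorm (pos x - pos y) ^+ 2 + enorm (vel x - vel y) ^+ 2 +
            enorm (rpos x - rpos y) ^+ 2 + enorm (err x - err y) ^+ 2 +
            enorm (est x - est y) ^+ 2).

Definition estimator_input (z : 'cV[R]_(ne * m)) (v : 'cV[R]_(n * m)) : 'cV[R]_ne :=
  - ((blockdiag z)^T *m (kron_id m incidence_tail)^T *m v).

Variables (zdes : 'cV[R]_(ne * m)) (mu : 'cV[R]_ne).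

Definition vector_field (x : state) : state :=
  let B := kron_id m incidence in
  let S1 := kron_id m incidence_tail in
  let D := blockdiag (rpos x) in
  {| pos := vel x;
     vel := - vel x - B *m D *m err x - S1 *m D *m (mu - est x);
     rpos := B^T *m vel x;
     err := 2 *: (D^T *m B^T *m vel x);
     est := estimator_input (rpos x) (vel x) |}.

(* z and e are not independent coordinates but functions of p. *)
Definition consistent (x : state) : Prop :=
  rpos x = relpos (pos x) /\ err x = error zdes (rpos x).

(* Two-sided derivatives at t = 0 lose nothing: a solution that is
   right-differentiable at 0 extends affinely to t < 0, where nothing is
   required. *)
Definition solution (T : \bar R) (x : R -> state) : Prop :=
  forall t : R, 0 <= t -> (t%:E < T)%E ->
    consistent (x t) /\
    [/\ is_derive t 1 (pos \o x) (pos (vector_field (x t))),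
        is_derive t 1 (vel \o x) (vel (vector_field (x t))),
        is_derive t 1 (rpos \o x) (rpos (vector_field (x t))),
        is_derive t 1 (err \o x) (err (vector_field (x t))) &
        is_derive t 1 (est \o x) (est (vector_field (x t)))].

Definition converges (x : R -> state) (y : state) : Prop :=
  sdist (x t) y @[t --> +oo] --> (0 : R).

Definition equilibrium (x : state) : Prop :=
  consistent x /\ vector_field x = State 0 0 0 0 0.

(* The equilibria form a continuum: translations and rotations of p map
   equilibria to equilibria, so no single one attracts a neighbourhood.
   Asymptotic stability of the equilibria is therefore Lyapunov stability of
   the point together with attraction of its neighbourhood by the equilibria,
   each nearby solution converging to one of them.  Lyapunov stability is
   required of solutions on every [0, T[, so it also excludes finite escape. *)
Definition asymptotically_stable (y : state) : Prop :=
  [/\ equilibrium y,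
      (forall eps : R, 0 < eps -> exists2 delta : R, 0 < delta &
         forall (T : \bar R) (x : R -> state), solution T x ->
           sdist (x 0) y < delta ->
           forall t : R, 0 <= t -> (t%:E < T)%E -> sdist (x t) y < eps) &
      exists2 delta : R, 0 < delta &
        forall x : R -> state, solution +oo%E x -> sdist (x 0) y < delta ->
          exists2 y' : state, equilibrium y' & converges x y'].

(* p is unrestricted up to z being close to the desired shape; e is then small
   for consistent states. *)
Definition near_desired (r : R) (x : state) : Prop :=
  [/\ exists2 z, desired_shape zdes z & enorm (rpos x - z) < r,
      enorm (vel x) < r & enorm (est x - mu) < r].

End Formation.

(* The control action is distributed: agent etail G k only needs z_k and its
   own velocity. *)
Lemma estimator_inputE (R : realType) m n ne (G : sensing_graph n ne)
    (z : 'cV[R]_(ne * m)) (v : 'cV[R]_(n * m)) k :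
  estimator_input G z v k 0 =
  - \sum_a block z k a 0 * block v (etail G k) a 0.
Proof.
rewrite /estimator_input mxE -mulmxA mxE; congr (- _).
have reidx q (F : 'I_(q * m) -> R) :
    \sum_r F r = \sum_(i < q) \sum_(a < m) F (mxtens_index (i, a)).
  rewrite pair_big /= (reindex (@mxtens_index q m)) /=.
    by apply: eq_bigr => -[i a].
  by exists (@mxtens_unindex q m) => ? _; rewrite ?mxtens_indexK ?mxtens_unindexK.
rewrite reidx (bigD1 k) //= [X in _ + X]big1 ?addr0; last first.
  move=> i ik; apply: big1 => a _.
  by rewrite !mxE mxtens_indexK /= (negPf ik) mul0r.
apply: eq_bigr => a _; rewrite !mxE mxtens_indexK /= eqxx; congr (_ * _).
rewrite reidx (bigD1 (etail G k)) //= [X in _ + X]big1 ?addr0; last first.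
  move=> i ik; apply: big1 => b _.
  rewrite !mxE !mxtens_indexK /= (negPf ik).
  by case: (i == ehead G k); rewrite ?eqxx ?mul0r // eq_sym oppr_eq0 oner_eq0 !mul0r.
rewrite (bigD1 a) //= [X in _ + X]big1 ?addr0; last first.
  by move=> b ba; rewrite !mxE !mxtens_indexK /= (negPf ba) mulr0 mul0r.
rewrite !mxE !mxtens_indexK /= !eqxx mulr1.
rewrite ifF ?mul1r //; apply/negbTE.
by rewrite -addr_eq0 (_ : 1 + 1 = 2%:R) // pnatr_eq0.
Qed.

(* Main.v *)
Require Import Defs.
From HB Require Import structures.
From mathcomp Require Import all_boot all_order all_algebra.
From mathcomp Require Import all_classical all_reals all_analysis.
From mathcomp Require Import mxtens ring lra zify.
Import Order.TTheory GRing.Theory Num.Theory.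
Import numFieldNormedType.Exports.
Local Open Scope classical_set_scope.
Local Open Scope ring_scope.
Set Implicit Arguments.
Unset Strict Implicit.
Unset Printing Implicit Defensive.

(** The equilibria are not isolated: besides the rigid motions there may be a
  continuum of pairs (e, muhat) whose forces cancel, so the state cannot have a
  strict Lyapunov function.  What decays exponentially is the velocity together
  with the force.

  Write g for the pair of e / sqrt 2 and mu - muhat.  The closed loop becomes
  v' = - v - A(z) g, z' = B^T v, g' = A(z)^T v, with A linear in z.  The same
  matrix carries g to the force and, transposed, the velocity back to g; hence
  |v|^2 + |g|^2 decreases, which is the bound on the final error
  (energy_bound).  With F = A(z) g and a fixed rotated copy z0 of the desired
  shape, consider

    |A(z0)^T v|^2 / 2 + |F|^2 / 2 + eps |v|^2 / 2 + eps v . F.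

  While z stays near z0 and g stays small, its derivative is negative definite
  in (v, F), provided that v . F is controlled by |A(z0)^T v| |F| up to small
  terms (transverse).  So v and F decay exponentially, the total displacement is
  proportional to the initial |v| + |F|, and a solution that starts near the
  desired shape never leaves its neighbourhood (exponential_trapping).  It
  therefore converges; its limit has v = 0 and F = 0, so it is an equilibrium
  (limit_equilibrium).  Near an equilibrium |v| + |F| is small, which makes the
  displacement small and gives Lyapunov stability.

  Transversality comes from rigidity.  The matrix A(z0) splits into one block
  for each agent, made of the edges at that agent.  With more agents than
  dimensions these edges span the space (incident_edges_span): a direction
  normal to them would give a flex moving one agent only, more than the rank of
  the rigidity matrix allows.  Then A(z0)^T is injective.  With as many agents
  as dimensions the graph is complete and the edges at each agent are
  independent (incident_edges_independent), because an affine dependency c of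
  the agents would give the self-stress c_i c_j.  Then A(z0) is injective.
  Fewer agents have no edge, hence no mismatch that could be nonzero.

  For triangles and tetrahedrons A(z0) is a square matrix, hence invertible, and
  F = 0 forces e = 0 and muhat = mu (simplex_equilibrium).  Equal edge lengths
  then give an isometry onto the desired shape, and nearness excludes
  reflections (congruent_near). *)

(** * Euclidean norms and scalar products of column vectors *)

Section Euclid.
Variable R : realType.
Implicit Types (a : R).

Definition dot k (x y : 'cV[R]_k) : R := \sum_i x i 0 * y i 0.

Lemma dotC k (x y : 'cV[R]_k) : dot x y = dot y x.
Proof. by apply: eq_bigr => i _; rewrite mulrC. Qed.

Lemma dotDr k (x y z : 'cV[R]_k) : dot x (y + z) = dot x y + dot x z.
Proof. by rewrite -big_split; apply: eq_bigr => i _; rewrite mxE mulrDr. Qed.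

Lemma dotDl k (x y z : 'cV[R]_k) : dot (x + y) z = dot x z + dot y z.
Proof. by rewrite dotC dotDr !(dotC z). Qed.

Lemma dotZr k a (x y : 'cV[R]_k) : dot x (a *: y) = a * dot x y.
Proof. by rewrite mulr_sumr; apply: eq_bigr => i _; rewrite mxE mulrCA. Qed.

Lemma dotZl k a (x y : 'cV[R]_k) : dot (a *: x) y = a * dot x y.
Proof. by rewrite dotC dotZr dotC. Qed.

Lemma dotNr k (x y : 'cV[R]_k) : dot x (- y) = - dot x y.
Proof. by rewrite -scaleN1r dotZr mulN1r. Qed.

Lemma dotNl k (x y : 'cV[R]_k) : dot (- x) y = - dot x y.
Proof. by rewrite dotC dotNr dotC. Qed.

Lemma dotBr k (x y z : 'cV[R]_k) : dot x (y - z) = dot x y - dot x z.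
Proof. by rewrite dotDr dotNr. Qed.

Lemma dotBl k (x y z : 'cV[R]_k) : dot (x - y) z = dot x z - dot y z.
Proof. by rewrite dotDl dotNl. Qed.

Lemma dot0r k (x : 'cV[R]_k) : dot x 0 = 0.
Proof. by rewrite -(scale0r 0) dotZr mul0r. Qed.

Lemma dot0l k (x : 'cV[R]_k) : dot 0 x = 0.
Proof. by rewrite dotC dot0r. Qed.

Lemma dot_sumr k I (r : seq I) (P : pred I) (x : 'cV[R]_k) (F : I -> 'cV[R]_k) :
  dot x (\sum_(i <- r | P i) F i) = \sum_(i <- r | P i) dot x (F i).
Proof.
elim/big_rec2 : _ => [|i a y _ <-]; first by rewrite dot0r.
by rewrite dotDr.
Qed.

Lemma dot_suml k I (r : seq I) (P : pred I) (x : 'cV[R]_k) (F : I -> 'cV[R]_k) :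
  dot (\sum_(i <- r | P i) F i) x = \sum_(i <- r | P i) dot (F i) x.
Proof. by rewrite dotC dot_sumr; apply: eq_bigr => i _; rewrite dotC. Qed.

Lemma dotE k (x y : 'cV[R]_k) : dot x y = (x^T *m y) 0 0.
Proof. by rewrite mxE; apply: eq_bigr => i _; rewrite mxE. Qed.

Lemma dot_mulmx k l (M : 'M[R]_(k, l)) x y : dot x (M *m y) = dot (M^T *m x) y.
Proof. by rewrite !dotE trmx_mul trmxK mulmxA. Qed.

Lemma dotxx_ge0 k (x : 'cV[R]_k) : 0 <= dot x x.
Proof. by apply: sumr_ge0 => i _; rewrite -expr2 sqr_ge0. Qed.

Lemma enorm_sqr k (x : 'cV[R]_k) : enorm x ^+ 2 = dot x x.
Proof.
rewrite sqr_sqrtr; first by apply: eq_bigr => i _; rewrite expr2.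
by apply: sumr_ge0 => i _; rewrite sqr_ge0.
Qed.

Lemma enorm_ge0 k (x : 'cV[R]_k) : 0 <= enorm x.
Proof. exact: sqrtr_ge0. Qed.

Lemma enormE k (x : 'cV[R]_k) : enorm x = Num.sqrt (dot x x).
Proof. by rewrite -enorm_sqr sqrtr_sqr ger0_norm // enorm_ge0. Qed.

Lemma dotxx_eq0 k (x : 'cV[R]_k) : dot x x = 0 -> x = 0.
Proof.
move/eqP; rewrite psumr_eq0 => [/allP h|i _]; last by rewrite -expr2 sqr_ge0.
apply/colP => i; rewrite mxE; apply/eqP; rewrite -sqrf_eq0 expr2.
by apply: h; rewrite mem_index_enum.
Qed.

Lemma enorm_eq0 k (x : 'cV[R]_k) : enorm x = 0 -> x = 0.
Proof. by move=> h; apply: dotxx_eq0; rewrite -enorm_sqr h expr0n. Qed.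

Lemma enorm0 k : enorm (0 : 'cV[R]_k) = 0.
Proof. by rewrite enormE dot0r sqrtr0. Qed.

Lemma enormN k (x : 'cV[R]_k) : enorm (- x) = enorm x.
Proof. by rewrite !enormE dotNl dotNr opprK. Qed.

Lemma enormB k (x y : 'cV[R]_k) : enorm (x - y) = enorm (y - x).
Proof. by rewrite -enormN opprB. Qed.

Lemma enormZ k a (x : 'cV[R]_k) : enorm (a *: x) = `|a| * enorm x.
Proof.
by rewrite !enormE dotZl dotZr mulrA -expr2 sqrtrM ?sqr_ge0 // sqrtr_sqr.
Qed.

Lemma dot_le_enorm k (x y : 'cV[R]_k) : dot x y <= enorm x * enorm y.
Proof.
have [/eqP|y0] := eqVneq (enorm y) 0.
  by move=> /eqP/enorm_eq0 ->; rewrite dot0r enorm0 mulr0.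
have yp : 0 < enorm y by rewrite lt_def y0 enorm_ge0.
have := dotxx_ge0 (enorm y *: x - enorm x *: y).
rewrite dotBl !dotBr !dotZl !dotZr -!enorm_sqr (dotC y x) => h.
have [xn|] := eqVneq (enorm x) 0.
  by rewrite (enorm_eq0 xn) dot0l enorm0 mul0r.
move=> x0; have xp : 0 < enorm x by rewrite lt_def x0 enorm_ge0.
have : 0 <= (enorm x * enorm y) * (enorm x * enorm y - dot x y) by nra.
by rewrite pmulr_rge0 ?mulr_gt0 // subr_ge0.
Qed.

Lemma abs_dot_le k (x y : 'cV[R]_k) : `|dot x y| <= enorm x * enorm y.
Proof.
rewrite ler_norml dot_le_enorm andbT lerNl -dotNl.
by rewrite (le_trans (dot_le_enorm _ _)) // enormN.
Qed.

Lemma ler_enormD k (x y : 'cV[R]_k) : enorm (x + y) <= enorm x + enorm y.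
Proof.
rewrite -ler_sqr ?nnegrE ?addr_ge0 ?enorm_ge0 //.
rewrite enorm_sqr dotDl !dotDr -!enorm_sqr (dotC y x).
by have := dot_le_enorm x y; nra.
Qed.

Lemma ler_enormB k (x y : 'cV[R]_k) : enorm (x - y) <= enorm x + enorm y.
Proof. by rewrite (le_trans (ler_enormD _ _)) // enormN. Qed.

Lemma ler_enorm_dist k (x y z : 'cV[R]_k) :
  enorm (x - y) <= enorm (x - z) + enorm (z - y).
Proof. by rewrite -[x - y](subrKA z) ler_enormD. Qed.

Lemma ler_enorm_sum k I (r : seq I) (F : I -> 'cV[R]_k) :
  enorm (\sum_(i <- r) F i) <= \sum_(i <- r) enorm (F i).
Proof.
elim: r => [|i r ih]; first by rewrite !big_nil enorm0.
by rewrite !big_cons (le_trans (ler_enormD _ _)) // lerD2l.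
Qed.

Lemma coord_le_enorm k (x : 'cV[R]_k) i : `|x i 0| <= enorm x.
Proof.
rewrite -ler_sqr ?nnegrE ?enorm_ge0 ?normr_ge0 // real_normK ?num_real //.
rewrite enorm_sqr /dot (bigD1 i) //= -expr2 lerDl.
by apply: sumr_ge0 => j _; rewrite -expr2 sqr_ge0.
Qed.

Lemma enorm_le_sum k (x : 'cV[R]_k) : enorm x <= \sum_i `|x i 0|.
Proof.
have {1}-> : x = \sum_i x i 0 *: delta_mx i 0.
  rewrite {1}(matrix_sum_delta x); apply: eq_bigr => i _.
  by rewrite big_ord1.
rewrite (le_trans (ler_enorm_sum _ _)) // ler_sum // => i _.
rewrite enormZ (_ : enorm _ = 1) ?mulr1 //.
rewrite enormE /dot (bigD1 i) //= big1 ?addr0 => [|j ji].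
  by rewrite mxE !eqxx mulr1 sqrtr1.
by rewrite mxE (negPf ji) mul0r.
Qed.

Lemma enorm_col_mx k l (x : 'cV[R]_k) (y : 'cV[R]_l) :
  enorm (col_mx x y) ^+ 2 = enorm x ^+ 2 + enorm y ^+ 2.
Proof.
rewrite !enorm_sqr /dot big_split_ord /=; congr (_ + _);
  by apply: eq_bigr => i _; rewrite ?col_mxEu ?col_mxEd.
Qed.

Lemma col_mx_le_enorm k l (x : 'cV[R]_k) (y : 'cV[R]_l) :
  enorm (col_mx x y) <= enorm x + enorm y.
Proof.
rewrite -ler_sqr ?nnegrE ?addr_ge0 ?enorm_ge0 // enorm_col_mx.
by have := enorm_ge0 x; have := enorm_ge0 y; nra.
Qed.

Lemma enorm_le_col_mxu k l (x : 'cV[R]_k) (y : 'cV[R]_l) :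
  enorm x <= enorm (col_mx x y).
Proof.
by rewrite -ler_sqr ?nnegrE ?enorm_ge0 // enorm_col_mx lerDl sqr_ge0.
Qed.

Lemma enorm_le_col_mxd k l (x : 'cV[R]_k) (y : 'cV[R]_l) :
  enorm y <= enorm (col_mx x y).
Proof.
by rewrite -ler_sqr ?nnegrE ?enorm_ge0 // enorm_col_mx lerDr sqr_ge0.
Qed.

Lemma colE_delta k (x : 'cV[R]_k) : x = \sum_i x i 0 *: delta_mx i 0.
Proof.
by rewrite {1}(matrix_sum_delta x); apply: eq_bigr => i _; rewrite big_ord1.
Qed.

Lemma linear_bounded k l (f : {linear 'cV[R]_k -> 'cV[R]_l}) :
  exists2 C, 0 < C & forall x, enorm (f x) <= C * enorm x.
Proof.
pose C := \sum_(i < k) enorm (f (delta_mx i 0)).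
have C0 : 0 <= C by apply: sumr_ge0 => i _; exact: enorm_ge0.
exists (C + 1) => [|x]; first by rewrite ltr_wpDl.
apply: (@le_trans _ _ (C * enorm x)); last first.
  by rewrite ler_wpM2r ?enorm_ge0 // lerDl.
rewrite {1}(colE_delta x) linear_sum /= (le_trans (ler_enorm_sum _ _)) //.
rewrite /C mulr_suml ler_sum // => i _.
by rewrite linearZ /= enormZ mulrC ler_wpM2l ?enorm_ge0 // coord_le_enorm.
Qed.

Lemma mulmx_bounded k l (M : 'M[R]_(l, k)) :
  exists2 C, 0 < C & forall x : 'cV_k, enorm (M *m x) <= C * enorm x.
Proof. exact: (linear_bounded (mulmx M)). Qed.

(** Linearity in each argument bounds a bilinear map by its values on the
  standard bases. *)
Lemma bilinear_bounded k l q (A : {linear 'cV[R]_k -> 'M[R]_(q, l)}) :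
  exists2 C, 0 < C & forall z (x : 'cV_l), enorm (A z *m x) <= C * enorm z * enorm x.
Proof.
pose M i := xget 1 [set C : R | 0 < C /\
  forall x : 'cV_l, enorm (A (delta_mx i 0) *m x) <= C * enorm x].
have MP i : 0 < M i /\ forall x : 'cV_l,
    enorm (A (delta_mx i 0) *m x) <= M i * enorm x.
  rewrite /M; case: xgetP => [y _ //|h].
  have [C C0 hC] := mulmx_bounded (A (delta_mx i 0)).
  by have := h C; case.
have C0 : 0 <= \sum_i M i by apply: sumr_ge0 => i _; case: (MP i) => /ltW.
exists (\sum_i M i + 1) => [|z x]; first by rewrite ltr_wpDl.
apply: (@le_trans _ _ ((\sum_i M i) * enorm z * enorm x)); last first.
  by rewrite ler_wpM2r ?enorm_ge0 // ler_wpM2r ?enorm_ge0 // lerDl.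
rewrite {1}(colE_delta z) linear_sum /= mulmx_suml.
rewrite (le_trans (ler_enorm_sum _ _)) // !mulr_suml ler_sum // => i _.
rewrite linearZ /= -scalemxAl enormZ (mulrC (M i)) -mulrA.
by rewrite ler_pM ?enorm_ge0 ?normr_ge0 ?coord_le_enorm //; case: (MP i).
Qed.

(** An injective matrix has a left inverse, whose boundedness is the
  estimate. *)
Lemma injective_bounded_below k l (M : 'M[R]_(l, k)) :
  (forall x : 'cV_k, M *m x = 0 -> x = 0) ->
  exists2 C, 0 < C & forall x : 'cV_k, enorm x <= C * enorm (M *m x).
Proof.
move=> inj.
have rf : row_free M^T.
  apply: inj_row_free => c cM; apply: trmx_inj; rewrite trmx0; apply: inj.
  by apply: trmx_inj; rewrite trmx_mul trmxK trmx0.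
have [N hN] := row_freeP rf.
have [C C0 hC] := mulmx_bounded N^T.
exists C => // x; rewrite (le_trans _ (hC _)) //.
by rewrite mulmxA -{1}[M]trmxK -trmx_mul hN trmx1 mul1mx.
Qed.

End Euclid.

(** * Differential calculus of vector-valued functions of time *)

Section Calculus.
Variable R : realType.
Implicit Types (t s a b c K : R).

Definition vderive k (x : R -> 'cV[R]_k) t (d : 'cV[R]_k) : Prop :=
  forall i, is_derive t 1 (fun s => x s i 0) (d i 0).

Lemma is_derive_vderive k (x : R -> 'cV[R]_k) t d :
  is_derive t 1 x d -> vderive x t d.
Proof.
case=> dx <- i; rewrite derive_mx // mxE.
by apply: DeriveDef => //; move/derivable_mxP : dx; exact.
Qed.

Lemma vderive_eq k (x : R -> 'cV[R]_k) t d d' :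
  vderive x t d -> d = d' -> vderive x t d'.
Proof. by move=> h <-. Qed.

Lemma vderive_ext k (x y : R -> 'cV[R]_k) t d :
  vderive x t d -> (forall s, x s = y s) -> vderive y t d.
Proof. by move=> h xy; rewrite (_ : y = x) //; apply/funext => s; rewrite xy. Qed.

Lemma vderive_cst k (x : 'cV[R]_k) t : vderive (fun=> x) t 0.
Proof. by move=> i; rewrite mxE; exact: is_derive_cst. Qed.

Lemma vderiveD k (x y : R -> 'cV[R]_k) t dx dy :
  vderive x t dx -> vderive y t dy -> vderive (fun s => x s + y s) t (dx + dy).
Proof.
move=> hx hy i; rewrite mxE.
rewrite (_ : (fun s => _) = (fun s => x s i 0) \+ (fun s => y s i 0)).
  exact: is_deriveD.
by apply/funext => s; rewrite mxE.
Qed.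

Lemma vderive_sum k I (r : seq I) (x : I -> R -> 'cV[R]_k) t dx :
  (forall i, vderive (x i) t (dx i)) ->
  vderive (fun s => \sum_(i <- r) x i s) t (\sum_(i <- r) dx i).
Proof.
move=> h; elim: r => [|i r ih].
  rewrite big_nil; apply: (vderive_ext (vderive_cst 0 t)) => s.
  by rewrite big_nil.
rewrite big_cons; apply: (vderive_ext (vderiveD (h i) ih)) => s.
by rewrite big_cons.
Qed.

Lemma vderiveZ k (x : R -> 'cV[R]_k) t a dx :
  vderive x t dx -> vderive (fun s => a *: x s) t (a *: dx).
Proof.
move=> hx i; rewrite mxE.
rewrite (_ : (fun s => _) = a \*: (fun s => x s i 0)); first exact: is_deriveZ.
by apply/funext => s; rewrite mxE.
Qed.

Lemma vderiveN k (x : R -> 'cV[R]_k) t dx :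
  vderive x t dx -> vderive (fun s => - x s) t (- dx).
Proof.
move=> /(vderiveZ (-1)) h; rewrite -scaleN1r; apply: (vderive_ext h) => s.
by rewrite scaleN1r.
Qed.

Lemma vderiveB k (x y : R -> 'cV[R]_k) t dx dy :
  vderive x t dx -> vderive y t dy -> vderive (fun s => x s - y s) t (dx - dy).
Proof. by move=> hx /vderiveN; exact: vderiveD. Qed.

Lemma is_derive_big_sum I (r : seq I) (f : I -> R -> R) t df :
  (forall i, is_derive t 1 (f i) (df i)) ->
  is_derive t 1 (fun s => \sum_(i <- r) f i s) (\sum_(i <- r) df i).
Proof.
move=> h; elim: r => [|i r ih].
  rewrite big_nil (_ : (fun s => _) = cst 0); first exact: is_derive_cst.
  by apply/funext => s; rewrite big_nil.
rewrite big_cons.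
rewrite (_ : (fun s => _) = f i \+ (fun s => \sum_(j <- r) f j s)).
  exact: is_deriveD.
by apply/funext => s; rewrite big_cons.
Qed.

Lemma is_derive_mul (f g : R -> R) t df dg :
  is_derive t 1 f df -> is_derive t 1 g dg ->
  is_derive t 1 (fun s => f s * g s) (df * g t + f t * dg).
Proof.
move=> hf hg; have h := is_deriveM hf hg.
by apply: is_derive_eq; rewrite addrC /GRing.scale /= mulrC.
Qed.

Lemma is_derive_dot k (x y : R -> 'cV[R]_k) t dx dy :
  vderive x t dx -> vderive y t dy ->
  is_derive t 1 (fun s => dot (x s) (y s)) (dot dx (y t) + dot (x t) dy).
Proof.
move=> hx hy; rewrite /dot -big_split.
by apply: is_derive_big_sum => i; exact: is_derive_mul.
Qed.

Lemma vderive_scale k (f : R -> R) (x : R -> 'cV[R]_k) t df dx :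
  is_derive t 1 f df -> vderive x t dx ->
  vderive (fun s => f s *: x s) t (df *: x t + f t *: dx).
Proof.
move=> hf hx i; rewrite !mxE.
rewrite (_ : (fun s => _) = (fun s => f s * x s i 0)); first exact: is_derive_mul.
by apply/funext => s; rewrite mxE.
Qed.

Lemma vderive_mulmx k l (M : 'M[R]_(l, k)) (x : R -> 'cV[R]_k) t dx :
  vderive x t dx -> vderive (fun s => M *m x s) t (M *m dx).
Proof.
have E (y : 'cV[R]_k) : M *m y = \sum_i y i 0 *: col i M.
  apply/colP => j; rewrite mxE summxE; apply: eq_bigr => i _.
  by rewrite !mxE mulrC.
move=> hx; rewrite E.
apply: (@vderive_ext _ (fun s => \sum_i x s i 0 *: col i M)); last first.
  by move=> s; rewrite E.
apply: vderive_sum => i; apply: vderive_eq.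
  exact: (vderive_scale (hx i) (vderive_cst (col i M) t)).
by rewrite scaler0 addr0.
Qed.

Lemma vderive_bilinear k l q (A : {linear 'cV[R]_k -> 'M[R]_(q, l)})
    (z : R -> 'cV[R]_k) (g : R -> 'cV[R]_l) t dz dg :
  vderive z t dz -> vderive g t dg ->
  vderive (fun s => A (z s) *m g s) t (A dz *m g t + A (z t) *m dg).
Proof.
have E (z' : 'cV[R]_k) (g' : 'cV[R]_l) :
    A z' *m g' = \sum_i z' i 0 *: (A (delta_mx i 0) *m g').
  rewrite {1}(colE_delta z') linear_sum mulmx_suml; apply: eq_bigr => i _.
  by rewrite linearZ /= -scalemxAl.
move=> hz hg.
apply: (@vderive_ext _ (fun s => \sum_i z s i 0 *: (A (delta_mx i 0) *m g s)));
  last by move=> s; rewrite E.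
rewrite !E -big_split; apply: vderive_sum => i.
exact: (vderive_scale (hz i) (vderive_mulmx _ hg)).
Qed.

Lemma is_derive_continuous (f : R -> R) t df :
  is_derive t 1 f df -> {for t, continuous f}.
Proof. by case=> hd _; apply/differentiable_continuous/derivable1_diffP. Qed.

Lemma is_derive_within (f df : R -> R) a b :
  (forall t, a <= t <= b -> is_derive t 1 f (df t)) ->
  {within `[a, b], continuous f}.
Proof.
move=> h; apply: continuous_in_subspaceT => t.
by rewrite inE /= in_itv /= => /h; exact: is_derive_continuous.
Qed.

Lemma mean_value (f df : R -> R) a b :
  a <= b -> (forall t, a <= t <= b -> is_derive t 1 f (df t)) ->
  exists2 t, a <= t <= b & f b - f a = df t * (b - a).
Proof.
move=> ab hf.
have hf' t : t \in `]a, b[%R -> is_derive t 1 f (df t).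
  by rewrite in_itv /= => /andP[/ltW ? /ltW ?]; apply: hf; apply/andP.
have [t] := MVT_segment ab hf' (is_derive_within hf).
by rewrite in_itv /= => ht E; exists t.
Qed.

Lemma nonincreasing_of_derive (f df : R -> R) a b :
  a <= b ->
  (forall t, a <= t <= b -> is_derive t 1 f (df t)) ->
  (forall t, a <= t <= b -> df t <= 0) -> f b <= f a.
Proof.
move=> ab hf df0.
have [c hc E] := mean_value ab hf; rewrite -subr_le0 E.
by rewrite mulr_le0_ge0 ?df0 // subr_ge0.
Qed.

Lemma is_derive_expRM c t : is_derive t 1 (fun s => expR (c * s)) (c * expR (c * t)).
Proof.
have h : is_derive t 1 (fun s => c * s) c.
  have h := is_deriveZ c (@is_derive_id _ _ t 1).
  by apply: is_derive_eq; rewrite /GRing.scale /= mulr1.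
have h2 := is_derive1_comp (is_derive_expR (c * t)) h.
by apply: is_derive_eq; rewrite mulrC.
Qed.

Lemma exponential_decay (W dW : R -> R) c b :
  0 <= b ->
  (forall t, 0 <= t <= b -> is_derive t 1 W (dW t)) ->
  (forall t, 0 <= t <= b -> dW t <= - c * W t) ->
  W b <= W 0 * expR (- c * b).
Proof.
move=> b0 hW le.
have : W b * expR (c * b) <= W 0 * expR (c * 0).
  apply: (nonincreasing_of_derive b0 (f := fun t => W t * expR (c * t))
    (df := fun t => dW t * expR (c * t) + W t * (c * expR (c * t)))).
    by move=> t ht; exact: is_derive_mul (hW _ ht) (is_derive_expRM c t).
  move=> t ht; rewrite (mulrA (W t)) -mulrDl.
  rewrite mulr_le0_ge0 ?expR_ge0 //.
  by have := le _ ht; lra.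
rewrite mulr0 expR0 mulr1 mulNr expRN => h.
by rewrite ler_pdivlMr ?expR_gt0.
Qed.

(** The velocity bound is integrated along the fixed direction of the
  displacement, which reduces it to a monotone function of time. *)
Lemma exponential_drift k (x y : R -> 'cV[R]_k) c K b :
  0 < c -> 0 <= K ->
  (forall t, 0 <= t <= b -> vderive x t (y t)) ->
  (forall t, 0 <= t <= b -> enorm (y t) <= K * expR (- c * t)) ->
  forall s t, 0 <= s -> s <= t -> t <= b ->
  enorm (x t - x s) <= K / c * expR (- c * s).
Proof.
move=> c0 K0 hx hy s t s0 st tb.
set u := x t - x s; set E := enorm u.
have [->|En] := eqVneq E 0; first by rewrite mulr_ge0 ?expR_ge0 // divr_ge0 // ltW.
have Ep : 0 < E by rewrite lt_def En enorm_ge0.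
have hr r : s <= r <= t -> 0 <= r <= b by move=> /andP[? ?]; lra.
pose f r := dot u (x r) + E * (K / c) * expR (- c * r).
have : f t <= f s.
  apply: (nonincreasing_of_derive st (df := fun r =>
    dot u (y r) + E * (K / c) * (- c * expR (- c * r)))) => r /hr hr'.
    have h1 := is_derive_dot (vderive_cst u r) (hx _ hr').
    have h2 := is_deriveZ (E * (K / c)) (is_derive_expRM (- c) r).
    rewrite dot0l add0r in h1.
    exact: (is_deriveD h1 h2).
  have -> : E * (K / c) * (- c * expR (- c * r)) = - (E * (K * expR (- c * r))).
    by field; rewrite gt_eqF.
  rewrite subr_le0 (le_trans (dot_le_enorm _ _)) // ler_wpM2l ?enorm_ge0 //.
  exact: hy.
rewrite /f => h.
have {}h : E * E <= E * (K / c) * expR (- c * s).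
  rewrite -expr2 enorm_sqr {2}/u dotBr.
  have : 0 <= E * (K / c) * expR (- c * t).
    by rewrite !mulr_ge0 ?expR_ge0 ?enorm_ge0 // invr_ge0 ltW.
  lra.
by rewrite -mulrA ler_pM2l in h.
Qed.

Lemma first_crossing (f df : R -> R) c b :
  0 <= b -> (forall t, 0 <= t <= b -> is_derive t 1 f (df t)) ->
  f 0 <= c -> c <= f b ->
  exists t1, [/\ 0 <= t1 <= b, f t1 = c & forall s, 0 <= s < t1 -> f s < c].
Proof.
move=> b0 hf f0c cb.
pose S := [set t | 0 <= t <= b /\ c <= f t].
have Sb : S b by split => //; rewrite b0 lexx.
have lS : lbound S 0 by move=> t [/andP[]].
have hS : has_inf S by split; [exists b | exists 0].
have t0 : 0 <= inf S by apply: lb_le_inf; [exists b | exact: lS].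
have tb : inf S <= b by apply: ge_inf; [exists 0 |].
have ct : {for inf S, continuous f}.
  by apply: is_derive_continuous (hf _ _); rewrite t0 tb.
have below s : 0 <= s < inf S -> f s < c.
  move=> /andP[s0 st]; rewrite ltNge; apply/negP => cs.
  have : inf S <= s.
    by apply: ge_inf; [exists 0|split => //; rewrite s0 (le_trans (ltW st))].
  by rewrite leNgt st.
exists (inf S); split; [by rewrite t0 tb| |exact: below].
apply/eqP; rewrite eq_le; apply/andP; split; rewrite leNgt; apply/negP => lt.
  have /nbhs_ballP[d /= d0 hd] : \forall s \near inf S, c < f s.
    exact: ct (lt_nbhsr lt).
  have [E|tn] := eqVneq (inf S) 0; first by move: lt; rewrite E; lra.
  have tp : 0 < inf S by rewrite lt_def tn.
  pose s := inf S - Num.min d (inf S) / 2.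
  have m0 : 0 < Num.min d (inf S) by rewrite lt_min d0.
  have md : Num.min d (inf S) <= d by rewrite ge_min lexx.
  have mt : Num.min d (inf S) <= inf S by rewrite ge_min lexx orbT.
  have : c < f s by apply: hd; rewrite /ball /= ltr_distlC /s; lra.
  have : f s < c by apply: below; rewrite /s; lra.
  lra.
have /nbhs_ballP[d /= d0 hd] : \forall s \near inf S, f s < c.
  exact: ct (lt_nbhsl lt).
have [s Ss sd] := inf_adherent d0 hS.
have is_ : inf S <= s by apply: ge_inf => //; exists 0.
have : f s < c by apply: hd; rewrite /ball /= ltr_distlC; lra.
by case: Ss => _; rewrite leNgt => /negP.
Qed.

(** The values of a function with exponentially shrinking oscillation are
  enclosed in nested intervals, whose common point is its limit. *)
Lemma exponential_limit1 (f : R -> R) c K :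
  (forall s t, 0 <= s -> s <= t -> `|f t - f s| <= K * expR (- c * s)) ->
  exists l, forall t, 0 <= t -> `|f t - l| <= K * expR (- c * t).
Proof.
move=> h; pose E := [set r | exists2 t, 0 <= t & r = f t - K * expR (- c * t)].
have hub t : 0 <= t -> ubound E (f t + K * expR (- c * t)).
  move=> t0 _ [s s0 ->].
  have p0 r : 0 <= r -> 0 <= K * expR (- c * r).
    by move=> r0; have := h r r r0 (lexx r); rewrite subrr normr0.
  have [st|/ltW ts] := leP s t.
    by have := h _ _ s0 st; rewrite ler_distl => /andP[? ?]; have := p0 _ t0; lra.
  by have := h _ _ t0 ts; rewrite ler_distl => /andP[? ?]; have := p0 _ s0; lra.
exists (sup E) => t t0; rewrite ler_distl; apply/andP; split.
  rewrite lerBlDr; apply: ge_sup; last exact: hub.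
  by exists (f 0 - K * expR (- c * 0)); exists 0.
rewrite -lerBlDr; apply: ub_le_sup; last by exists t.
by exists (f t + K * expR (- c * t)); exact: hub.
Qed.

Lemma exponential_limit k (x : R -> 'cV[R]_k) c K :
  (forall s t, 0 <= s -> s <= t -> enorm (x t - x s) <= K * expR (- c * s)) ->
  exists l, forall t, 0 <= t -> enorm (x t - l) <= k%:R * K * expR (- c * t).
Proof.
move=> h.
have /choice[l hl] : forall i, exists l, forall t, 0 <= t ->
    `|x t i 0 - l| <= K * expR (- c * t).
  move=> i; apply: (exponential_limit1 (f := fun t => x t i 0)) => s t s0 st.
  by apply: le_trans (h _ _ s0 st); have := coord_le_enorm (x t - x s) i; rewrite !mxE.
exists (\col_i l i) => t t0; rewrite (le_trans (enorm_le_sum _)) //.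
rewrite -mulrA -[k in k%:R]card_ord -sumr_const mulr_suml ler_sum // => i _.
by rewrite !mxE mul1r; exact: hl.
Qed.

(** By the mean value theorem f(t+1) - f(t), which vanishes in the limit, is a
  value of the derivative. *)
Lemma derive_limit_eq0 (f df : R -> R) (l d : R) :
  (forall t, 0 <= t -> is_derive t 1 f (df t)) ->
  f x @[x --> +oo] --> l -> df x @[x --> +oo] --> d -> d = 0.
Proof.
move=> hf fl dfd; apply/eqP; rewrite -normr_le0; apply/ler_addgt0Pl => e e0.
rewrite addr0.
have e3 : 0 < e / 3 by rewrite divr_gt0.
have /cvgrPdist_lt/(_ _ e3)[M1 [_ h1]] := fl.
have /cvgrPdist_lt/(_ _ e3)[M2 [_ h2]] := dfd.
pose t := Num.max 0 (Num.max M1 M2) + 1.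
have [t0 t1 t2] : [/\ 0 <= t, M1 < t & M2 < t].
  have m0 : 0 <= Num.max 0 (Num.max M1 M2) by rewrite le_max lexx.
  have m1 : M1 <= Num.max 0 (Num.max M1 M2) by rewrite !le_max lexx orbT.
  have m2 : M2 <= Num.max 0 (Num.max M1 M2) by rewrite !le_max lexx !orbT.
  by rewrite /t; split; lra.
have hr r : t <= r <= t + 1 -> is_derive r 1 f (df r).
  by move=> /andP[? ?]; apply: hf; lra.
have tt : t <= t + 1 by lra.
have [r /andP[tr rt] E] := mean_value tt hr.
have := h1 _ t1; have := h1 (t + 1) ltac:(lra); have := h2 r ltac:(lra).
rewrite /= !ltr_distl => /andP[? ?] /andP[? ?] /andP[? ?].
by rewrite ler_norml; nra.
Qed.

End Calculus.

(** * Exponential decay of velocity and force in a quadratic flow *)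

(** The scalar inequality behind the decay.  Here a, b and f are the norms of
  the detected velocity, of the velocity and of the force, and k is the size of
  the neighbourhood times the bound M on the data.  The only indefinite terms
  that are not small with k are 2 eps X4 and eps X5; they are of order
  eps M a f and eps a^2, so that a^2 and eps f^2 absorb them once eps M^2 is
  small. *)
Lemma lyapunov_rate (R : realType) (M k a b f X1 X2 X3 X4 X5 : R) :
  let eps := (16 * M ^+ 2)^-1 in
  1 <= M -> 0 <= k <= eps / 16 -> 0 <= a -> 0 <= b -> 0 <= f ->
  X1 <= k * b * f -> X2 <= k * b * f -> X3 <= k * b ^+ 2 ->
  `|X4| <= M * a * f + k * b * f -> `|X4| <= b * f -> X5 <= (a + k * b) ^+ 2 ->
  - a ^+ 2 + X1 + X2 - eps * b ^+ 2 - 2 * eps * X4 - eps * f ^+ 2 + eps * X3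
    + eps * X5 <=
  - (eps / 2) * (a ^+ 2 / 2 + f ^+ 2 / 2 + eps / 2 * b ^+ 2 + eps * X4).
Proof.
move=> eps M1 /andP[k0 k1] a0 b0 f0 h1 h2 h3 h4 h4' h5.
have M2 : 1 <= M ^+ 2 by rewrite expr_ge1 // (le_trans ler01).
have e0 : 0 < eps by rewrite invr_gt0; lra.
have eM : eps * M ^+ 2 = 1 / 16.
  by rewrite /eps; field; apply/lt0r_neq0; lra.
have e1 : eps <= 1 / 16 by rewrite -eM ler_peMr // ltW.
have e16 x : 0 <= x -> eps * x <= x / 16 by move=> x0; have := ler_wpM2r x0 e1; lra.
have small x y : 0 <= y -> x <= eps / 16 * y -> eps * x <= eps / 256 * y.
  move=> y0 xy; have := ler_wpM2l (ltW e0) xy.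
  by have := e16 _ (mulr_ge0 (ltW e0) y0); lra.
have aa := sqr_ge0 a; have bb := sqr_ge0 b; have ff := sqr_ge0 f.
have bf0 : 0 <= b * f by rewrite mulr_ge0.
have bf : b * f <= b ^+ 2 / 2 + f ^+ 2 / 2 by have := sqr_ge0 (b - f); lra.
set q := b ^+ 2 / 2 + f ^+ 2 / 2 in bf *.
have q0 : 0 <= q by rewrite /q addr_ge0 ?divr_ge0.
have kb : k * b * f <= eps / 16 * q.
  rewrite -mulrA; apply: le_trans (ler_wpM2r bf0 k1) _; rewrite ler_wpM2l //; lra.
have kbb : k * b ^+ 2 <= eps / 16 * b ^+ 2 by rewrite ler_wpM2r.
have Maf : 2 * eps * (M * a * f) <= a ^+ 2 / 2 + eps / 8 * f ^+ 2.
  have := sqr_ge0 (a - 2 * eps * M * f).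
  have -> : (a - 2 * eps * M * f) ^+ 2
    = a ^+ 2 - 2 * (2 * eps * (M * a * f)) + 4 * eps * (eps * M ^+ 2) * f ^+ 2.
    by ring.
  rewrite eM; clear; lra.
have e5 : eps * X5 <= a ^+ 2 / 8 + eps / 256 * b ^+ 2.
  have kk : k ^+ 2 <= eps / 32.
    rewrite expr2; apply: (@le_trans _ _ (eps / 16 * (1 / 32))); last by lra.
    by apply: ler_pM => //; lra.
  have h : eps * (X5 - 2 * a ^+ 2) <= eps / 256 * b ^+ 2.
    apply: small => //; have := ler_wpM2r bb kk; have := sqr_ge0 (a - k * b).
    move: h5; clear; lra.
  have := e16 _ aa; move: h; clear; lra.
have e3 : eps * X3 <= eps / 256 * b ^+ 2 by apply: small => //; exact: le_trans kbb.
have e4 : - (2 * eps * X4) <= a ^+ 2 / 2 + eps / 8 * f ^+ 2 + 2 * (eps / 256 * q).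
  have hX : - X4 <= M * a * f + k * b * f by move: h4; rewrite ler_norml => /andP[]; lra.
  have := ler_wpM2l (ltW e0) hX; have := small _ _ q0 kb.
  move: Maf; clear; lra.
have e4' : eps / 2 * (eps * X4) <= eps / 32 * q.
  have hX : X4 <= q by move: h4'; rewrite ler_norml => /andP[_ /le_trans]; apply.
  have := ler_wpM2l (ltW e0) (ler_wpM2l (ltW e0) hX).
  have := e16 _ (mulr_ge0 (ltW e0) q0); clear; lra.
have eb := mulr_ge0 (ltW e0) bb; have ef := mulr_ge0 (ltW e0) ff.
have e6 := e16 _ eb; have e7 := e16 _ aa; have e8 := e16 _ ff.
move: h1 h2 kb e3 e4 e4' e5 e6 e7 e8 eb ef aa; rewrite /q; clear; lra.
Qed.

Section Trapping.
Variables (R : realType) (K N L : nat).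
Variables (A : {linear 'cV[R]_K -> 'M[R]_(N, L)}) (Bt : 'M[R]_(K, N)).
Implicit Types (T : \bar R) (v : R -> 'cV[R]_N) (z : R -> 'cV[R]_K)
  (g : R -> 'cV[R]_L).

(** The closed loop with the error and the estimation mismatch gathered in one
  vector g: the agents feel friction and the restoring force - A(z) g, and the
  transpose of A(z) feeds the velocity back into g. *)
Definition flow T v z g := forall t : R, 0 <= t -> (t%:E < T)%E ->
  [/\ vderive v t (- v t - A (z t) *m g t),
      vderive z t (Bt *m v t) &
      vderive g t ((A (z t))^T *m v t)].

(** Near z0, a velocity can do work against the forces only through the
  component that the transpose of A(z0) detects.  Injectivity of A(z0) and
  injectivity of its transpose both imply this, and it is all that the decay
  needs of them. *)
Definition transverse (C0 rho0 : R) (z0 : 'cV[R]_K) :=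
  forall (z : 'cV[R]_K) (g : 'cV[R]_L) (v : 'cV[R]_N), enorm (z - z0) <= rho0 ->
  `|dot v (A z *m g)| <=
    C0 * (enorm ((A z0)^T *m v) + enorm (z - z0) * enorm v) * enorm (A z *m g).

Lemma adjoint_bounded : exists2 C, 0 < C & forall (z : 'cV_K) (v : 'cV_N),
  enorm ((A z)^T *m v) <= C * enorm z * enorm v.
Proof. exact: (bilinear_bounded (trmx \o A)). Qed.


(** A Lyapunov function for velocity and force.  In the first two terms the
  exchange between the force and the detected velocity cancels to leading
  order, and friction dissipates the detected velocity; the cross term, with
  the small weight eps, makes the force dissipate as well. *)
Definition energy (eps : R) (z0 : 'cV[R]_K) v z g (t : R) : R :=
  enorm ((A z0)^T *m v t) ^+ 2 / 2 + enorm (A (z t) *m g t) ^+ 2 / 2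
  + eps / 2 * enorm (v t) ^+ 2 + eps * dot (v t) (A (z t) *m g t).

Lemma energy_derive eps (z0 : 'cV[R]_K) T v z g (t : R) :
  flow T v z g -> 0 <= t -> (t%:E < T)%E ->
  let F := A (z t) *m g t in
  let w (x : 'cV_K) := (A x)^T *m v t in
  is_derive t 1 (energy eps z0 v z g)
   (- enorm (w z0) ^+ 2
    + (dot ((A (z t))^T *m F) (w (z t)) - dot ((A z0)^T *m F) (w z0))
    + dot F (A (Bt *m v t) *m g t) - eps * enorm (v t) ^+ 2
    - 2 * eps * dot (v t) F - eps * enorm F ^+ 2
    + eps * dot (v t) (A (Bt *m v t) *m g t) + eps * enorm (w (z t)) ^+ 2).
Proof.
move=> fl t0 tT F w; have [dv dz dg] := fl t t0 tT.
have dw := vderive_mulmx (A z0)^T dv; have dF := vderive_bilinear A dz dg.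
have h1 := is_deriveZ (2^-1) (is_derive_dot dw dw).
have h2 := is_deriveZ (2^-1) (is_derive_dot dF dF).
have h3 := is_deriveZ (eps / 2) (is_derive_dot dv dv).
have h4 := is_deriveZ eps (is_derive_dot dv dF).
have h := is_deriveD (is_deriveD (is_deriveD h1 h2) h3) h4.
rewrite (_ : energy _ _ _ _ _ = (((2^-1 \*: (fun s => dot ((A z0)^T *m v s)
   ((A z0)^T *m v s))) \+ (2^-1 \*: (fun s => dot (A (z s) *m g s)
   (A (z s) *m g s)))) \+ ((eps / 2) \*: (fun s => dot (v s) (v s))))
   \+ (eps \*: (fun s => dot (v s) (A (z s) *m g s)))); last first.
  apply/funext => s; rewrite /energy !enorm_sqr /GRing.scale /=.
  by rewrite !(mulrC _ 2^-1).
apply: is_derive_eq; rewrite !enorm_sqr /GRing.scale /=.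
rewrite -/F -!/(w _) !mulmxBr !mulmxN -!/(w _).
have E1 : dot F (A (z t) *m w (z t)) = dot ((A (z t))^T *m F) (w (z t)).
  by rewrite dot_mulmx.
have E2 : dot (v t) (A (z t) *m w (z t)) = dot (w (z t)) (w (z t)).
  by rewrite dot_mulmx.
rewrite !(dotDl, dotDr, dotNl, dotNr) E2.
rewrite [dot (A (z t) *m w (z t)) F]dotC E1.
rewrite [dot ((A z0)^T *m F) (w z0)]dotC [dot F (v t)]dotC.
rewrite [dot (A (Bt *m v t) *m g t) F]dotC.
by field.
Qed.

Lemma decay_while_near (C0 rho0 Z : R) : 0 < C0 -> 0 < rho0 -> 0 <= Z ->
  exists C c rho : R, [/\ 0 < C, 0 < c, 0 < rho &
  forall z0 : 'cV[R]_K, enorm z0 <= Z -> transverse C0 rho0 z0 ->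
  forall T v z g, flow T v z g -> forall b : R, 0 <= b -> (b%:E < T)%E ->
  (forall s, 0 <= s <= b ->
    enorm (z s - z0) ^+ 2 + enorm (g s) ^+ 2 <= rho ^+ 2) ->
  enorm (v b) <= C * (enorm (v 0) + enorm (A (z 0) *m g 0)) * expR (- c * b) /\
  enorm (A (z b) *m g b) <=
    C * (enorm (v 0) + enorm (A (z 0) *m g 0)) * expR (- c * b)].
Proof.
move=> C0p rho0p Z0.
have [KA KA0 hA] := bilinear_bounded A.
have [KT KT0 hT] := adjoint_bounded.
have [KB KB0 hB] := mulmx_bounded Bt.
(* M bounds all the data; eps is chosen against M, and rho against M and eps. *)
pose M := 1 + C0 + KT + 2 * KT ^+ 2 * (Z + 1) + KA * KB + KT * Z.
have [[M1 MC MT] [MTT MAB MZ]] : [/\ 1 <= M, C0 <= M & KT <= M] /\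
    [/\ 2 * KT ^+ 2 * (Z + 1) <= M, KA * KB <= M & KT * Z <= M].
  have p1 : 0 <= 2 * KT ^+ 2 * (Z + 1) by rewrite !mulr_ge0 ?sqr_ge0 //; lra.
  have p2 : 0 <= KA * KB by rewrite mulr_ge0 // ltW.
  have p3 : 0 <= KT * Z by rewrite mulr_ge0 // ltW.
  by rewrite /M; split; split; lra.
have M0 : 0 < M by lra.
pose eps := (16 * M ^+ 2)^-1.
have M2 : 1 <= M ^+ 2 by rewrite expr_ge1 // ltW.
have e0 : 0 < eps by rewrite invr_gt0; lra.
have e1 : eps <= 1 / 16.
  by rewrite /eps -[1 / 16]/(1 * 16^-1) mul1r lef_pV2 ?posrE; lra.
pose rho := Num.min (Num.min 1 rho0) (eps / 16 / M).
have rho_p : 0 < rho by rewrite !lt_min ltr01 rho0p !divr_gt0.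
have rho1 : rho <= 1 by rewrite !ge_min lexx.
have rho2 : rho <= rho0 by rewrite !ge_min lexx orbT.
have rho3 : M * rho <= eps / 16.
  by rewrite mulrC -ler_pdivlMr // ge_min lexx orbT.
pose D := 4 / eps * (1 + M ^+ 2).
have D1 : 1 <= D.
  have : 1 <= eps^-1 by rewrite invf_ge1 //; lra.
  by rewrite /D; nra.
exists D, (eps / 4), rho; split => //; [lra|lra|].
move=> z0 z0Z tr T v z g fl b b0 bT near.
have near' s : 0 <= s <= b -> enorm (z s - z0) <= rho /\ enorm (g s) <= rho.
  move=> /near; have := sqr_ge0 (enorm (z s - z0)); have := sqr_ge0 (enorm (g s)).
  by move=> *; split; rewrite -ler_sqr ?nnegrE ?enorm_ge0 ?(ltW rho_p) //; lra.
set W := energy eps z0 v z g.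
have Wdecay : W b <= W 0 * expR (- (eps / 2) * b).
  apply: exponential_decay b0 _ _ => t /andP[t0 tb].
    by apply: energy_derive fl t0 _; apply: le_lt_trans bT; rewrite lee_fin.
  have [nz ng] := near' t ltac:(by rewrite t0 tb).
  set F := A (z t) *m g t; set V := v t.
  set E := A (z t - z0).
  have AE (x : 'cV_N) : (A (z t))^T *m x = E^T *m x + (A z0)^T *m x.
    by rewrite -mulmxDl -linearD /= /E -linearD /= subrK.
  have hE (x : 'cV_N) : enorm (E^T *m x) <= KT * rho * enorm x.
    apply: le_trans (hT _ _) _; rewrite ler_wpM2r ?enorm_ge0 //.
    by rewrite ler_wpM2l // ltW.
  have h0 (x : 'cV_N) : enorm ((A z0)^T *m x) <= KT * Z * enorm x.
    apply: le_trans (hT _ _) _; rewrite ler_wpM2r ?enorm_ge0 //.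
    by rewrite ler_wpM2l // ltW.
  have b_0 := enorm_ge0 V; have f_0 := enorm_ge0 F.
  have a_0 := enorm_ge0 ((A z0)^T *m V).
  have hBv : enorm (A (Bt *m V) *m g t) <= M * rho * enorm V.
    apply: le_trans (hA _ _) _.
    apply: (@le_trans _ _ (KA * (KB * enorm V) * rho)).
      by rewrite ler_pM ?mulr_ge0 ?enorm_ge0 ?(ltW KA0) // ler_wpM2l // ltW.
    rewrite [leLHS](_ : _ = KA * KB * rho * enorm V); last by ring.
    by rewrite ler_wpM2r // ler_wpM2r // ltW.
  have bf0 : 0 <= rho * enorm V * enorm F by rewrite !mulr_ge0 // ltW.
  apply: (lyapunov_rate (M := M) (k := M * rho) (f := enorm F)) => //.
  - by rewrite rho3 mulr_ge0 // ltW.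
  - rewrite -/V -/F !AE dotDl !dotDr.
    have -> : forall p q r s : R, p + q + (r + s) - s = p + q + r by move=> *; ring.
    apply: (@le_trans _ _ ((KT * rho * enorm F) * (KT * enorm V)
      + (KT * rho * enorm F) * (KT * Z * enorm V)
      + (KT * Z * enorm F) * (KT * rho * enorm V))).
      have hE1 (x : 'cV_N) : enorm (E^T *m x) <= KT * enorm x.
        apply: le_trans (hE x) _; rewrite ler_wpM2r ?enorm_ge0 //.
        by rewrite ler_piMr // ltW.
      by rewrite !lerD // (le_trans (dot_le_enorm _ _)) // ler_pM ?enorm_ge0.
    rewrite [leLHS](_ : _ = KT ^+ 2 * (1 + 2 * Z) * (rho * enorm V * enorm F));
      last by ring.
    rewrite [leRHS](_ : _ = M * (rho * enorm V * enorm F)); last by ring.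
    rewrite ler_wpM2r // (le_trans _ MTT) //.
    by have := sqr_ge0 KT; nra.
  - apply: le_trans (dot_le_enorm _ _) _.
    by rewrite mulrC ler_wpM2r.
  - apply: le_trans (dot_le_enorm _ _) _.
    by rewrite expr2 mulrCA ler_wpM2l.
  - have := tr (z t) (g t) V (le_trans nz rho2) => /le_trans; apply.
    rewrite -/F -mulrDl ler_wpM2r // mulrDr lerD //.
      by rewrite ler_wpM2r.
    by rewrite mulrA ler_wpM2r // ler_pM // ?enorm_ge0 // ltW.
  - exact: abs_dot_le.
  - rewrite ler_sqr ?nnegrE ?addr_ge0 ?mulr_ge0 ?enorm_ge0 //; try exact: ltW.
    rewrite AE addrC (le_trans (ler_enormD _ _)) // lerD2l.
    by apply: le_trans (hE _) _; rewrite !ler_wpM2r // ltW.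
set N0 := enorm (v 0) + enorm (A (z 0) *m g 0).
have N00 : 0 <= N0 by rewrite addr_ge0 ?enorm_ge0.
have young x y : eps * (x * y) <= eps / 4 * x ^+ 2 + eps * y ^+ 2.
  rewrite -mulrA -mulrDr ler_wpM2l //; first by rewrite ltW.
  by have := sqr_ge0 (x / 2 - y); lra.
have W0 : W 0 <= (1 + M ^+ 2) * N0 ^+ 2.
  rewrite /W /energy.
  have ha : enorm ((A z0)^T *m v 0) ^+ 2 <= M ^+ 2 * enorm (v 0) ^+ 2.
    rewrite -exprMn ler_sqr ?nnegrE ?mulr_ge0 ?enorm_ge0 ?(ltW M0) //.
    apply: le_trans (hT _ _) _; rewrite ler_wpM2r ?enorm_ge0 //.
    by rewrite (le_trans _ MZ) // ler_wpM2l // ltW.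
  have hd := ler_wpM2l (ltW e0) (dot_le_enorm (v 0) (A (z 0) *m g 0)).
  have hy := young (enorm (v 0)) (enorm (A (z 0) *m g 0)).
  have v_0 := enorm_ge0 (v 0); have f_0 := enorm_ge0 (A (z 0) *m g 0).
  have vf := mulr_ge0 v_0 f_0.
  have N2 : enorm (v 0) ^+ 2 + enorm (A (z 0) *m g 0) ^+ 2 <= N0 ^+ 2.
    by rewrite /N0; lra.
  have v2 := sqr_ge0 (enorm (v 0)); have f2 := sqr_ge0 (enorm (A (z 0) *m g 0)).
  have ev : eps * enorm (v 0) ^+ 2 <= 1 / 16 * enorm (v 0) ^+ 2 by rewrite ler_wpM2r.
  have ef : eps * enorm (A (z 0) *m g 0) ^+ 2 <=
    1 / 16 * enorm (A (z 0) *m g 0) ^+ 2 by rewrite ler_wpM2r.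
  have MN : M ^+ 2 * enorm (v 0) ^+ 2 <= M ^+ 2 * N0 ^+ 2.
    by rewrite ler_wpM2l ?sqr_ge0 //; lra.
  have := sqr_ge0 (M * enorm (v 0)); rewrite exprMn.
  lra.
have e4 : 4 / eps = 4 * eps^-1 by [].
have Wb : eps / 4 * enorm (v b) ^+ 2 <= W b /\
    eps / 4 * enorm (A (z b) *m g b) ^+ 2 <= W b.
  rewrite /W /energy.
  have hd := ler_wpM2l (ltW e0) (abs_dot_le (v b) (A (z b) *m g b)).
  have hd' : - (eps * dot (v b) (A (z b) *m g b)) <=
      eps * `|dot (v b) (A (z b) *m g b)|.
    by rewrite -mulrN ler_wpM2l ?(ltW e0) // lerNl lerNnormlW.
  have hy := young (enorm (v b)) (enorm (A (z b) *m g b)).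
  have := sqr_ge0 (enorm ((A z0)^T *m v b)).
  have v2 := sqr_ge0 (enorm (v b)); have f2 := sqr_ge0 (enorm (A (z b) *m g b)).
  have ev : 0 <= eps * enorm (v b) ^+ 2 by rewrite mulr_ge0 // ltW.
  have ef : eps * enorm (A (z b) *m g b) ^+ 2 <=
    1 / 16 * enorm (A (z b) *m g b) ^+ 2 by rewrite ler_wpM2r.
  by split; lra.
have final x : 0 <= x -> eps / 4 * x ^+ 2 <= W b ->
    x <= D * N0 * expR (- (eps / 4) * b).
  move=> x0 hx.
  have DN : 0 <= D * N0 by apply: mulr_ge0 => //; lra.
  have P0 : 0 <= D * N0 * expR (- (eps / 4) * b).
    by apply: mulr_ge0 => //; exact: expR_ge0.
  rewrite -ler_sqr ?nnegrE //.
  have EE : expR (- (eps / 4) * b) ^+ 2 = expR (- (eps / 2) * b).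
    by rewrite expr2 -expRD; congr expR; field.
  rewrite [leRHS](_ : _ = D ^+ 2 * (N0 ^+ 2 * expR (- (eps / 4) * b) ^+ 2));
    last by ring.
  rewrite EE; set Ex := expR _.
  have Ex0 : 0 <= N0 ^+ 2 * Ex by rewrite mulr_ge0 ?sqr_ge0 ?expR_ge0.
  apply: (@le_trans _ _ (D * (N0 ^+ 2 * Ex))); last first.
    have DD : D <= D ^+ 2 by rewrite ler_eXnr.
    exact: ler_wpM2r.
  rewrite /D -mulrA -ler_pdivrMl ?divr_gt0 // invf_div.
  rewrite (le_trans hx) // (le_trans Wdecay) // mulrA.
  by rewrite ler_wpM2r ?expR_ge0.
by case: Wb => Wv Wf; split; apply: final => //; exact: enorm_ge0.
Qed.

End Trapping.

Section Bootstrap.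
Variables (R : realType) (K N L : nat).
Variables (A : {linear 'cV[R]_K -> 'M[R]_(N, L)}) (Bt : 'M[R]_(K, N)).

(** The decay holds while the flow stays near z0, and makes its total
  displacement proportional to its initial velocity and force; if these are
  small the flow never leaves. *)
Theorem exponential_trapping (C0 rho0 Z : R) : 0 < C0 -> 0 < rho0 -> 0 <= Z ->
  exists C c delta : R, [/\ 0 < C, 0 < c, 0 < delta &
  forall z0 : 'cV[R]_K, enorm z0 <= Z -> transverse A C0 rho0 z0 ->
  forall T v z g, flow A Bt T v z g ->
  enorm (z 0 - z0) <= delta -> enorm (g 0) <= delta -> enorm (v 0) <= delta ->
  forall t, 0 <= t -> (t%:E < T)%E ->
  enorm (v t) <= C * (enorm (v 0) + enorm (A (z 0) *m g 0)) * expR (- c * t) /\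
  enorm (A (z t) *m g t) <=
    C * (enorm (v 0) + enorm (A (z 0) *m g 0)) * expR (- c * t)].
Proof.
move=> C0p rho0p Z0.
have [KA KA0 hA] := bilinear_bounded A.
have [KT KT0 hT] := adjoint_bounded A.
have [KB KB0 hB] := mulmx_bounded Bt.
have [C [c [rho [Cp cp rhop hdecay]]]] := decay_while_near A Bt C0p rho0p Z0.
pose Q := C / c * (1 + KA * (Z + 1)).
have Q0 : 0 < Q by rewrite !mulr_gt0 ?invr_gt0 // ltr_pwDl // mulr_ge0 // ?ltW //; lra.
pose P := 1 + KB * Q + KT * (Z + rho) * Q.
have [PB PT P1] : [/\ 1 + KB * Q <= P, 1 + KT * (Z + rho) * Q <= P & 1 <= P].
  have p1 : 0 <= KB * Q by rewrite mulr_ge0 ?ltW.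
  have p2 : 0 <= KT * (Z + rho) * Q.
    by rewrite mulr_ge0 ?(ltW Q0) // mulr_ge0 ?(ltW KT0) //; lra.
  by rewrite /P; split; lra.
pose delta := Num.min 1 (rho / 2 / P).
have P0 : 0 < P by lra.
have d0 : 0 < delta by rewrite lt_min ltr01 !divr_gt0.
have d1 : delta <= 1 by rewrite ge_min lexx.
have d2 : P * delta <= rho / 2 by rewrite mulrC -ler_pdivlMr // ge_min lexx orbT.
exists C, c, delta; split => // z0 z0Z tr T v z g fl hz hg hv t t0 tT.
set N0 := enorm (v 0) + enorm (A (z 0) *m g 0).
have N00 : 0 <= N0 by rewrite addr_ge0 ?enorm_ge0.
have N0d : C / c * N0 <= Q * delta.
  rewrite /Q -[leRHS]mulrA ler_pM2l ?divr_gt0 // mulrDl mul1r lerD //.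
  apply: le_trans (hA _ _) _; rewrite -!mulrA ler_wpM2l ?(ltW KA0) //.
  rewrite ler_pM ?enorm_ge0 // -(subrK z0 (z 0)).
  by rewrite (le_trans (ler_enormD _ _)) // addrC lerD // (le_trans hz).
have early s : 0 <= s <= t -> (s%:E < T)%E.
  by move=> /andP[_ st]; apply: le_lt_trans tT; rewrite lee_fin.
pose phi s := dot (z s - z0) (z s - z0) + dot (g s) (g s).
have phiE s : phi s = enorm (z s - z0) ^+ 2 + enorm (g s) ^+ 2.
  by rewrite !enorm_sqr.
suff near s : 0 <= s <= t -> phi s <= rho ^+ 2.
  by apply: (hdecay z0 z0Z tr T v z g fl t t0 tT) => q /near; rewrite phiE.
(* At the first time t1 at which the flow reached the boundary of the
   neighbourhood, the accumulated drift would still be at most half its radius. *)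
move=> /andP[s0 st]; rewrite leNgt; apply/negP => lt.
have dphi r : 0 <= r <= s -> is_derive r 1 phi
    (dot (Bt *m v r - 0) (z r - z0) + dot (z r - z0) (Bt *m v r - 0)
     + (dot ((A (z r))^T *m v r) (g r) + dot (g r) ((A (z r))^T *m v r))).
  move=> /andP[r0 rs].
  have [_ dz dg] := fl r r0 (early r ltac:(rewrite r0 (le_trans rs st) //)).
  have dz' := vderiveB dz (vderive_cst z0 r).
  exact: is_deriveD (is_derive_dot dz' dz') (is_derive_dot dg dg).
have Pd : delta <= rho / 2 by apply: le_trans d2; rewrite ler_peMl // ltW.
have sq x : 0 <= x -> x <= rho / 2 -> x ^+ 2 <= rho ^+ 2 / 4.
  move=> x0 hx; rewrite (_ : rho ^+ 2 / 4 = (rho / 2) ^+ 2); last by field.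
  by rewrite ler_sqr ?nnegrE //; lra.
have rho2 : 0 < rho ^+ 2 by rewrite exprn_gt0.
have phi0 : phi 0 <= rho ^+ 2.
  rewrite phiE; have := sq _ (enorm_ge0 _) (le_trans hz Pd).
  by have := sq _ (enorm_ge0 _) (le_trans hg Pd); lra.
have [t1 [/andP[t10 t1s] phit1 below]] := first_crossing s0 dphi phi0 (ltW lt).
have inside r : 0 <= r <= t1 -> phi r <= rho ^+ 2.
  move=> /andP[r0]; rewrite le_eqVlt => /predU1P[->|rt]; first by rewrite phit1.
  by apply/ltW/below; rewrite r0.
have t1t : t1 <= t := le_trans t1s st.
have early1 r : 0 <= r <= t1 -> (r%:E < T)%E.
  by move=> /andP[r0 rt]; apply: early; rewrite r0 (le_trans rt).
have hvr r : 0 <= r <= t1 -> enorm (v r) <= C * N0 * expR (- c * r).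
  move=> rt; have /andP[r0 rt1] := rt.
  have h q : 0 <= q <= r -> enorm (z q - z0) ^+ 2 + enorm (g q) ^+ 2 <= rho ^+ 2.
    by move=> /andP[q0 qr]; rewrite -phiE inside // q0 (le_trans qr).
  by have [] := hdecay z0 z0Z tr T v z g fl r r0 (early1 r rt) h.
have zr r : 0 <= r <= t1 -> enorm (z r) <= Z + rho.
  move=> /inside; rewrite phiE => h.
  rewrite -(subrK z0 (z r)) (le_trans (ler_enormD _ _)) // addrC lerD //.
  rewrite -ler_sqr ?nnegrE ?enorm_ge0 ?(ltW rhop) //.
  by have := sqr_ge0 (enorm (g r)); lra.
have driftz : enorm (z t1 - z 0) <= KB * (C * N0) / c * expR (- c * 0).
  apply: (@exponential_drift _ _ z (fun r => Bt *m v r) c _ t1) => //.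
  - by rewrite !mulr_ge0 // ltW.
  - by move=> r rt; case/andP: (rt) => r0 _; case: (fl r r0 (early1 r rt)).
  - move=> r rt; apply: le_trans (hB _) _.
    by rewrite -mulrA ler_wpM2l ?(ltW KB0) //; exact: hvr.
have driftg : enorm (g t1 - g 0) <= KT * (Z + rho) * (C * N0) / c * expR (- c * 0).
  apply: (@exponential_drift _ _ g (fun r => (A (z r))^T *m v r) c _ t1) => //.
  - by rewrite !mulr_ge0 ?(ltW KT0) ?(ltW Cp) //; lra.
  - by move=> r rt; case/andP: (rt) => r0 _; case: (fl r r0 (early1 r rt)).
  - move=> r rt; apply: le_trans (hT _ _) _.
    rewrite -[leRHS]mulrA ler_pM ?mulr_ge0 ?enorm_ge0 ?(ltW KT0) //.
      by rewrite ler_wpM2l ?(ltW KT0) //; exact: zr.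
    exact: hvr.
move: driftz driftg; rewrite mulr0 expR0 !mulr1 => driftz driftg.
have hz1 : enorm (z t1 - z0) <= rho / 2.
  apply: le_trans (ler_enorm_dist _ _ (z 0)) _; apply: le_trans d2.
  apply: (@le_trans _ _ ((1 + KB * Q) * delta)); last by rewrite ler_wpM2r // ltW.
  rewrite mulrDl mul1r addrC lerD // (le_trans driftz) //.
  rewrite [leLHS](_ : _ = KB * (C / c * N0)); last by ring.
  rewrite [leRHS](_ : _ = KB * (Q * delta)); last by ring.
  by rewrite ler_wpM2l // ltW.
have hg1 : enorm (g t1) <= rho / 2.
  rewrite -(subrK (g 0) (g t1)).
  apply: le_trans (ler_enormD _ _) _; apply: le_trans d2.
  apply: (@le_trans _ _ ((1 + KT * (Z + rho) * Q) * delta)); last first.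
    by rewrite ler_wpM2r // ltW.
  rewrite mulrDl mul1r addrC lerD // (le_trans driftg) //.
  rewrite [leLHS](_ : _ = KT * (Z + rho) * (C / c * N0)); last by ring.
  rewrite [leRHS](_ : _ = KT * (Z + rho) * (Q * delta)); last by ring.
  by rewrite ler_wpM2l // mulr_ge0 ?(ltW KT0) //; lra.
move: phit1; rewrite phiE.
have := sq _ (enorm_ge0 _) hz1; have := sq _ (enorm_ge0 _) hg1.
lra.
Qed.

End Bootstrap.

(** * Stacked vectors and the matrices of the formation *)

Section Blocks.
Variable R : realType.

Definition stack m k (f : 'I_k -> 'cV[R]_m) : 'cV[R]_(k * m) :=
  \col_r f (mxtens_unindex r).1 (mxtens_unindex r).2 0.

Lemma stackK m k (f : 'I_k -> 'cV[R]_m) i : block (stack f) i = f i.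
Proof. by apply/colP => a; rewrite !mxE mxtens_indexK. Qed.

Lemma block_inj m k (x y : 'cV[R]_(k * m)) :
  (forall i, block x i = block y i) -> x = y.
Proof.
move=> h; apply/colP => r; case: (mxtens_indexP r) => i a.
by have /colP/(_ a) := h i; rewrite !mxE.
Qed.

Lemma block0 m k i : block (0 : 'cV[R]_(k * m)) i = 0.
Proof. by apply/colP => a; rewrite !mxE. Qed.

Lemma blockD m k (x y : 'cV[R]_(k * m)) i : block (x + y) i = block x i + block y i.
Proof. by apply/colP => a; rewrite !mxE. Qed.

Lemma blockZ m k a (x : 'cV[R]_(k * m)) i : block (a *: x) i = a *: block x i.
Proof. by apply/colP => b; rewrite !mxE. Qed.

Lemma blockN m k (x : 'cV[R]_(k * m)) i : block (- x) i = - block x i.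
Proof. by apply/colP => b; rewrite !mxE. Qed.

Lemma blockB m k (x y : 'cV[R]_(k * m)) i : block (x - y) i = block x i - block y i.
Proof. by rewrite blockD blockN. Qed.

Lemma sum_mxtens m k (F : 'I_(k * m) -> R) :
  \sum_r F r = \sum_(i < k) \sum_(a < m) F (mxtens_index (i, a)).
Proof.
rewrite pair_big /= (reindex (@mxtens_index k m)) /=.
  by apply: eq_bigr => -[i a].
by exists (@mxtens_unindex k m) => ? _; rewrite ?mxtens_indexK ?mxtens_unindexK.
Qed.

Lemma dot_block m k (x y : 'cV[R]_(k * m)) :
  dot x y = \sum_i dot (block x i) (block y i).
Proof.
rewrite /dot sum_mxtens; apply: eq_bigr => i _; apply: eq_bigr => a _.
by rewrite !mxE.
Qed.

Lemma enorm_block_le m k (x : 'cV[R]_(k * m)) i : enorm (block x i) <= enorm x.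
Proof.
rewrite -ler_sqr ?nnegrE ?enorm_ge0 // !enorm_sqr dot_block (bigD1 i) //= lerDl.
by apply: sumr_ge0 => j _; exact: dotxx_ge0.
Qed.

Lemma block_tens1 m k (Q : 'M[R]_m) (x : 'cV[R]_(k * m)) i :
  block (tensmx (1%:M : 'M[R]_k) Q *m x) i = Q *m block x i.
Proof.
apply/colP => a; rewrite !mxE sum_mxtens (bigD1 i) //= [X in _ + X]big1 ?addr0.
  by apply: eq_bigr => b _; rewrite !mxE !mxtens_indexK /= eqxx mul1r.
move=> j ji; apply: big1 => b _.
by rewrite !mxE !mxtens_indexK /= eq_sym (negPf ji) !mul0r.
Qed.

Lemma block_kron m k l (M : 'M[R]_(k, l)) (x : 'cV[R]_(l * m)) i :
  block (kron_id m M *m x) i = \sum_j M i j *: block x j.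
Proof.
apply/colP => a; rewrite !mxE summxE sum_mxtens; apply: eq_bigr => j _.
rewrite (bigD1 a) //= [X in _ + X]big1 ?addr0.
  by rewrite !mxE !mxtens_indexK /= eqxx mulr1.
by move=> b ba; rewrite !mxE !mxtens_indexK /= eq_sym (negPf ba) mulr0 mul0r.
Qed.

Lemma kron_tr m k l (M : 'M[R]_(k, l)) : (kron_id m M)^T = kron_id m M^T.
Proof. by rewrite /kron_id trmx_tens trmx1. Qed.

Lemma block_blockdiag m l (z : 'cV[R]_(l * m)) (e : 'cV[R]_l) k :
  block (blockdiag z *m e) k = e k 0 *: block z k.
Proof.
apply/colP => a; rewrite !mxE (bigD1 k) //= [X in _ + X]big1 ?addr0.
  by rewrite !mxE mxtens_indexK /= eqxx mulrC.
by move=> j jk; rewrite !mxE mxtens_indexK /= eq_sym (negPf jk) mul0r.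
Qed.

Lemma blockdiag_trE m l (z x : 'cV[R]_(l * m)) k :
  ((blockdiag z)^T *m x) k 0 = dot (block z k) (block x k).
Proof.
rewrite mxE sum_mxtens (bigD1 k) //= [X in _ + X]big1 ?addr0.
  by apply: eq_bigr => a _; rewrite !mxE mxtens_indexK /= eqxx.
move=> j jk; apply: big1 => a _.
by rewrite !mxE mxtens_indexK /= (negPf jk) mul0r.
Qed.

End Blocks.

Section FormationMatrices.
Variables (R : realType) (m n ne : nat) (G : sensing_graph n ne).
Implicit Types (p v : 'cV[R]_(n * m)) (z : 'cV[R]_(ne * m)) (k : 'I_ne).

Definition incident i k := (etail G k == i) || (ehead G k == i).

Lemma sum_incidence (V : lmodType R) (f : 'I_n -> V) k :
  \sum_i incidence R G i k *: f i = f (etail G k) - f (ehead G k).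
Proof.
have th : ehead G k != etail G k by rewrite eq_sym etail_neq_ehead.
rewrite (bigD1 (etail G k)) //= (bigD1 (ehead G k)) //= big1 ?addr0 => [|i].
  by rewrite !mxE !eqxx (negPf th) scale1r scaleN1r.
by move=> /andP[it ih]; rewrite !mxE (negPf it) (negPf ih) scale0r.
Qed.

Lemma incidence_tailE i k : incidence_tail R G i k = (i == etail G k)%:R.
Proof.
rewrite !mxE; case: (eqVneq i (etail G k)) => [_|it].
  by rewrite ifF //; apply/negbTE; rewrite -addr_eq0 -[1 + 1]/(2%:R) pnatr_eq0.
by case: (eqVneq i (ehead G k)) => _; rewrite ?eqxx // ?if_same.
Qed.

Lemma block_relpos p k :
  block (relpos G p) k = block p (etail G k) - block p (ehead G k).
Proof.
rewrite /relpos kron_tr block_kron -(sum_incidence (block p)).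
by apply: eq_bigr => i _; rewrite mxE.
Qed.

Lemma rigidityE z p k : (rigidity_matrix G z *m p) k 0 =
  dot (block z k) (block p (etail G k) - block p (ehead G k)).
Proof. by rewrite -mulmxA blockdiag_trE block_relpos. Qed.

Lemma tail_trE z v k :
  ((blockdiag z)^T *m (kron_id m (incidence_tail R G))^T *m v) k 0 =
  dot (block z k) (block v (etail G k)).
Proof.
rewrite -mulmxA blockdiag_trE kron_tr block_kron; congr dot.
rewrite (bigD1 (etail G k)) //= big1 ?addr0 => [|i /negPf it].
  by rewrite mxE incidence_tailE eqxx scale1r.
by rewrite mxE incidence_tailE it scale0r.
Qed.

Lemma block_incidence_diag z (e : 'cV[R]_ne) i :
  block (kron_id m (incidence R G) *m blockdiag z *m e) i =
  \sum_k (incidence R G i k * e k 0) *: block z k.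
Proof.
rewrite -mulmxA block_kron; apply: eq_bigr => k _.
by rewrite block_blockdiag scalerA.
Qed.

Lemma block_tail_diag z (e : 'cV[R]_ne) i :
  block (kron_id m (incidence_tail R G) *m blockdiag z *m e) i =
  \sum_k ((i == etail G k)%:R * e k 0) *: block z k.
Proof.
rewrite -mulmxA block_kron; apply: eq_bigr => k _.
by rewrite block_blockdiag scalerA incidence_tailE.
Qed.

End FormationMatrices.

(** * Rigid frameworks have no degenerate node *)

Section LinearAlgebra.
Variable F : fieldType.

Lemma kernel_family_bound k l (M : 'M[F]_(k, l)) (I : finType) (w : I -> 'cV[F]_l) :
  (forall i, M *m w i = 0) ->
  (forall a : I -> F, \sum_i a i *: w i = 0 -> forall i, a i = 0) ->
  (#|I| + \rank M <= l)%N.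
Proof.
move=> Mw indep; pose K : 'M[F]_(#|I|, l) := \matrix_(j < #|I|) (w (enum_val j))^T.
have KM : K *m M^T = 0.
  by apply/row_matrixP => j; rewrite row_mul rowK -trmx_mul Mw trmx0 row0.
have := mulmx0_rank_max KM; rewrite mxrank_tr (_ : \rank K = #|I|) //.
apply/eqP/inj_row_free => c cK; apply/rowP => j; rewrite mxE.
have := indep (fun i => c 0 (enum_rank i)) _ (enum_val j).
rewrite enum_valK; apply; apply: trmx_inj; rewrite trmx0 -cK mulmx_sum_row.
rewrite linear_sum (reindex (@enum_val I I)) /=; last first.
  by exists enum_rank => i _; rewrite ?enum_rankK ?enum_valK.
by apply: eq_bigr => i _; rewrite linearZ /= rowK enum_valK.
Qed.

End LinearAlgebra.

(** A skew matrix has even rank; over an ordered field the case of rank one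
  follows from its diagonal: x_a y_b = - x_b y_a squares to - (x_a y_a)(x_b y_b). *)
Lemma skew_rank_le1 (R : realFieldType) m (W : 'M[R]_m) :
  W^T = - W -> (\rank W <= 1)%N -> W = 0.
Proof.
move=> skew; have key r (C : 'M[R]_(m, r)) (D : 'M[R]_(r, m)) :
    (r <= 1)%N -> C *m D = W -> W = 0.
  case: r C D => [|[|//]] C D _ E; first by
    rewrite -E; apply/matrixP => i j; rewrite !mxE big_ord0.
  have WE a b : W a b = C a 0 * D 0 b by rewrite -E mxE big_ord1.
  have skewE a b : W a b = - W b a by move/matrixP/(_ b a): skew; rewrite !mxE.
  have diag a : C a 0 * D 0 a = 0 by have := skewE a a; rewrite WE => h; lra.
  apply/matrixP => a b; rewrite [RHS]mxE; apply/eqP; rewrite -sqrf_eq0 expr2.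
  rewrite {2}skewE !WE mulrN oppr_eq0.
  rewrite [X in X == 0](_ : _ = (C a 0 * D 0 a) * (C b 0 * D 0 b)); last by ring.
  by rewrite diag mul0r.
by move=> h; apply: (key _ (col_base W) (row_base W)); rewrite ?mulmx_base.
Qed.

Definition skew_pair m := {ab : 'I_m * 'I_m | (ab.1 < ab.2)%N}.

Definition skew_unit (R : pzRingType) m (s : skew_pair m) : 'M[R]_m :=
  delta_mx (val s).1 (val s).2 - delta_mx (val s).2 (val s).1.

(** In dimensions two and three, 3 m - 3 is the number m (m + 1) / 2 of
  independent infinitesimal rigid motions. *)
Lemma card_skew_pair m : (m = 2 \/ m = 3)%N -> (m + #|{: skew_pair m}| = 3 * m - 3)%N.
Proof.
rewrite card_sig -sum1_card => h.
rewrite (eq_bigl (fun ab : 'I_m * 'I_m => true && (ab.1 < ab.2)%N)) //.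
rewrite -(pair_big_dep predT (fun a b : 'I_m => (a < b)%N) (fun _ _ => 1%N)) /=.
under eq_bigr do rewrite big_mkcond.
by case: h => ->; rewrite !big_ord_recl !big_ord0.
Qed.

Lemma skew_unit_indep (R : pzRingType) m (a : skew_pair m -> R) :
  \sum_s a s *: skew_unit R s = 0 -> forall s, a s = 0.
Proof.
move=> h [[i j] /= ij]; move/matrixP/(_ i j): h; rewrite mxE summxE.
rewrite (bigD1 (exist _ (i, j) ij)) //= big1 ?addr0.
  rewrite !mxE !eqxx /= [j == i]eq_sym.
  by rewrite (_ : i == j = false) ?subr0 ?mulr1 //; apply/negbTE; rewrite neq_ltn ij.
move=> [[i' j'] /= ij'] ne; rewrite !mxE /=.
rewrite (_ : (i == i') && (j == j') = false) ?sub0r; last first.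
  by apply/negbTE; apply: contra ne => h; apply/eqP/val_inj => /=;
      case/andP: h => /eqP -> /eqP ->.
rewrite (_ : (i == j') && (j == i') = false) ?oppr0 ?mulr0 //.
by apply/negbTE/negP => /andP[/eqP ei /eqP ej]; have := ij'; rewrite /= -ei -ej ltnNge ltnW.
Qed.

Lemma skew_unit_skew (R : pzRingType) m (a : skew_pair m -> R) :
  let W := \sum_s a s *: skew_unit R s in W^T = - W.
Proof.
rewrite /= linear_sum -sumrN; apply: eq_bigr => s _.
by rewrite linearZ /= /skew_unit linearB /= !trmx_delta -scalerN opprB.
Qed.

Lemma skew_dot (R : realType) m (W : 'M[R]_m) (x : 'cV_m) :
  W^T = - W -> dot x (W *m x) = 0.
Proof.
by move=> skew; have := dot_mulmx W x x; rewrite skew mulNmx dotNl dotC; lra.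
Qed.

Section NodeSpan.
Variables (R : realType) (m n ne : nat) (G : sensing_graph n ne).
Variable p : 'cV[R]_(n * m).
Let z := relpos G p.
Implicit Types (v : 'cV[R]_(n * m)).

Lemma flexP v :
  rigidity_matrix G z *m v = 0 <->
  forall k, dot (block z k) (block v (etail G k) - block v (ehead G k)) = 0.
Proof.
split => [h k|h]; first by rewrite -rigidityE h mxE.
by apply/colP => k; rewrite rigidityE mxE h.
Qed.

(** Homogeneous coordinates: an affine dependency of the agents is a linear
  dependency of the rows, and an affine map is a product by a matrix. *)
Definition homogeneous : 'M[R]_(n, m + 1) :=
  \matrix_(i < n) row_mx (block p i)^T (1%:M : 'M[R]_1).

Definition homogeneous_but i : 'M[R]_(n, m + 1) :=
  \matrix_(j < n) (if j == i then 0 else row j homogeneous).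

(** The infinitesimal rigid motions: translations along the axes and rotations
  in the coordinate planes. *)
Definition trivial_flex (x : 'I_m + skew_pair m) : 'cV[R]_(n * m) :=
  stack (fun j => match x with
                  | inl a => delta_mx a 0
                  | inr s => skew_unit R s *m block p j
                  end).

Lemma trivial_flexP x : rigidity_matrix G z *m trivial_flex x = 0.
Proof.
apply/flexP => k; rewrite !stackK; case: x => [a|s]; first by rewrite subrr dot0r.
rewrite -mulmxBr /z block_relpos skew_dot // /skew_unit.
by rewrite linearB /= !trmx_delta opprB.
Qed.

Lemma sum_trivial_flex (a : 'I_m + skew_pair m -> R) j :
  block (\sum_x a x *: trivial_flex x) j =
  \col_b a (inl b) + (\sum_s a (inr s) *: skew_unit R s) *m block p j.
Proof.
have -> : block (\sum_x a x *: trivial_flex x) j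
    = \sum_x a x *: block (trivial_flex x) j.
  elim/big_rec2 : _ => [|x u v _ <-]; first by rewrite block0.
  by rewrite blockD blockZ.
rewrite big_sumType /= mulmx_suml; congr (_ + _).
  rewrite [RHS]colE_delta; apply: eq_bigr => b _.
  by rewrite stackK mxE.
by apply: eq_bigr => s _; rewrite stackK scalemxAl.
Qed.

(** If u were orthogonal to the edges at agent i, moving agent i along u would
  be a flex.  It is not an infinitesimal rigid motion: the other agents span at
  least a hyperplane, and a rigid motion that fixes them vanishes.  So there
  would be more flexes than the rank allows. *)
Lemma flex_single_agent i (u : 'cV[R]_m) :
  (m = 2 \/ m = 3)%N -> (\rank (rigidity_matrix G z) + (3 * m - 3) = n * m)%N ->
  (m <= \rank (homogeneous_but i))%N ->
  (forall k, incident G i k -> dot (block z k) u = 0) -> u = 0.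
Proof.
move=> hm hrank hH hu; apply/eqP; apply: contraT => u0.
pose w (x : unit + ('I_m + skew_pair m)) : 'cV[R]_(n * m) :=
  match x with
  | inl _ => stack (fun j => if j == i then u else 0)
  | inr y => trivial_flex y
  end.
have flex : forall x, rigidity_matrix G z *m w x = 0.
  move=> [[]|y]; last exact: trivial_flexP.
  apply/flexP => k; rewrite !stackK.
  have := hu k; rewrite /incident; have := etail_neq_ehead G k.
  case: (eqVneq (etail G k) i) => [ti|_]; case: (eqVneq (ehead G k) i) => [hi|_] /=.
  - by rewrite ti hi eqxx.
  - by move=> _ /(_ isT); rewrite subr0.
  - by move=> _ /(_ isT); rewrite sub0r dotNr => ->; rewrite oppr0.
  - by rewrite subrr dot0r.
have := kernel_family_bound flex.
rewrite !card_sum card_unit card_ord card_skew_pair //.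
move=> bound; have /bound : forall a, \sum_x a x *: w x = 0 -> forall x, a x = 0; last first.
  by move: hrank; lia.
move=> a; rewrite big_sumType /= => h.
pose W := \sum_s a (inr (inr s)) *: skew_unit R s.
pose t : 'cV_m := \col_b a (inr (inl b)).
have hj j : (if j == i then a (inl tt) *: u else 0) + (t + W *m block p j) = 0.
  have : block (0 : 'cV[R]_(n * m)) j = 0 by rewrite block0.
  rewrite -h blockD (sum_trivial_flex (fun x => a (inr x))) /= => E.
  rewrite -[RHS]E; congr (_ + _); rewrite (big_pred1 tt); last by case.
  by rewrite blockZ stackK; case: (j == i); rewrite ?scaler0.
pose F := col_mx W^T t^T.
(* The affine map with linear part W and constant part t vanishes at all agents
   but i, so its matrix F has rank at most one. *)
have HF : homogeneous_but i *m F = 0.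
  apply/row_matrixP => j; rewrite row_mul rowK row0; have := hj j.
  case: (j == i) => [_|]; first by rewrite mul0mx.
  rewrite add0r rowK mul_row_col mul1mx -trmx_mul -linearD /= addrC => ->.
  by rewrite trmx0.
have W0 : W = 0.
  apply: skew_rank_le1; first exact: skew_unit_skew.
  rewrite -mxrank_tr (_ : W^T = row_mx 1%:M 0 *m F); last first.
    by rewrite mul_row_col mul1mx mul0mx addr0.
  apply: leq_trans (mxrankM_maxr _ _) _.
  rewrite -(leq_add2l m) (leq_trans _ (mulmx0_rank_max HF)) //.
  by rewrite leq_add2r.
have [j ji] : exists j, j != i.
  apply/existsP; apply: contraT; rewrite negb_exists => /forallP /= all_i.
  have H0 : homogeneous_but i = 0.
    by apply/row_matrixP => j; rewrite rowK row0 (negPn (all_i j)).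
  by move: hH; rewrite H0 mxrank0; case: hm => ->.
have t0 : t = 0.
  by have := hj j; rewrite (negPf ji) W0 mul0mx addr0 add0r.
have a0 : a (inl tt) = 0.
  have := hj i; rewrite eqxx t0 W0 mul0mx !addr0 => /eqP.
  by rewrite scaler_eq0 (negPf u0) orbF => /eqP.
move=> [[]//|[b|s]].
  by move/colP/(_ b): t0; rewrite !mxE.
exact: (skew_unit_indep (a := fun s => a (inr (inr s)))).
Qed.

(** A vector of the right kernel is an affine function that vanishes at all
  agents, so its linear part is normal to every edge. *)
Lemma homogeneous_kernel (a : 'cV[R]_(m + 1)) k :
  homogeneous *m a = 0 -> dot (block z k) (usubmx a) = 0.
Proof.
move=> h.
have hj j : dot (block p j) (usubmx a) = - a (rshift m 0) 0.
  have : row j (homogeneous *m a) 0 0 = 0 by rewrite h row0 mxE.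
  rewrite row_mul rowK -{1}[a]vsubmxK mul_row_col mul1mx mxE -dotE !mxE.
  by move/eqP; rewrite addr_eq0 => /eqP.
by rewrite /z block_relpos dotBl !hj subrr.
Qed.

Lemma homogeneous_kernel_neq0 (a : 'cV[R]_(m + 1)) : (0 < n)%N ->
  homogeneous *m a = 0 -> usubmx a = 0 -> a = 0.
Proof.
move=> n0 h u0; rewrite -[a]vsubmxK u0.
have : row (Ordinal n0) (homogeneous *m a) = 0 by rewrite h row0.
rewrite row_mul rowK -{1}[a]vsubmxK mul_row_col u0 mulmx0 add0r mul1mx => ->.
by rewrite col_mx0.
Qed.

Lemma dual_kernel k l (M : 'M[R]_(k, l)) : (\rank M < l)%N ->
  exists2 a : 'cV_l, M *m a = 0 & a != 0.
Proof.
rewrite -mxrank_tr => h; pose c := nz_row (kermx M^T).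
have c0 : c != 0 by rewrite nz_row_eq0 -mxrank_eq0 mxrank_ker subn_eq0 -ltnNge.
exists c^T; last by rewrite trmx_eq0.
apply: trmx_inj; rewrite trmx_mul trmxK trmx0.
by apply/eqP; rewrite -[_ == _]/(c *m M^T == 0) -sub_kermx nz_row_sub.
Qed.

(** If the agents lay in a subspace of codimension two, each would be free to
  move in two independent directions, giving more flexes than the rank allows. *)
Lemma homogeneous_rank_ge :
  (m = 2 \/ m = 3)%N -> (\rank (rigidity_matrix G z) + (3 * m - 3) = n * m)%N ->
  (m < n)%N -> (m <= \rank homogeneous)%N.
Proof.
move=> hm hrank mn; rewrite leqNgt; apply/negP => lt.
have n0 : (0 < n)%N by lia.
pose K := row_base (kermx homogeneous^T).
have rK : (1 < \rank (kermx homogeneous^T))%N.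
  by rewrite mxrank_ker mxrank_tr; lia.
have hK s : homogeneous *m (row s K)^T = 0.
  apply: trmx_inj; rewrite trmx_mul trmxK trmx0; apply/eqP.
  rewrite -sub_kermx; apply: submx_trans (row_sub _ _) _.
  by rewrite eq_row_base.
pose w (x : 'I_n * 'I_(\rank (kermx homogeneous^T))) : 'cV[R]_(n * m) :=
  stack (fun j => if j == x.1 then usubmx (row x.2 K)^T else 0).
have flex : forall x, rigidity_matrix G z *m w x = 0.
  move=> x; apply/flexP => k; rewrite !stackK dotBr.
  by do 2 case: ifP => _; rewrite ?dot0r ?homogeneous_kernel ?subrr ?hK.
have := kernel_family_bound flex; rewrite card_prod !card_ord => bound.
have /bound : forall a, \sum_x a x *: w x = 0 -> forall x, a x = 0; last first.
  have n2 : (n * 2 <= n * \rank (kermx homogeneous^T))%N by rewrite leq_mul2l rK orbT.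
  have count r1 r2 d : (d = 2 \/ d = 3)%N -> (d < n)%N ->
    (r1 + (3 * d - 3) = n * d)%N -> (n * 2 <= r2)%N -> (r2 + r1 <= n * d)%N -> False.
    by case=> ->; lia.
  by move=> b; have := count _ _ _ hm mn hrank n2 b.
move=> a h [j s].
have hj : \sum_s a (j, s) *: usubmx (row s K)^T = 0.
  have : block (0 : 'cV[R]_(n * m)) j = 0 by rewrite block0.
  rewrite -h => E; rewrite -[RHS]E.
  have -> : block (\sum_x a x *: w x) j = \sum_x a x *: block (w x) j.
    elim/big_rec2 : _ => [|x u v _ <-]; first by rewrite block0.
    by rewrite blockD blockZ.
  rewrite (eq_bigr (fun x => a (x.1, x.2) *: block (w (x.1, x.2)) j)); last by case.
  rewrite -(pair_bigA _ (fun i s => a (i, s) *: block (w (i, s)) j)) /=.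
  rewrite (bigD1 j) //= [X in _ = _ + X]big1 ?addr0.
    by apply: eq_bigr => s' _; rewrite stackK eqxx.
  move=> i ij; apply: big1 => s' _.
  by rewrite stackK eq_sym (negPf ij) scaler0.
pose b : 'rV_(\rank (kermx homogeneous^T)) := \row_s a (j, s).
have bK : (b *m K)^T = \sum_s a (j, s) *: (row s K)^T.
  rewrite mulmx_sum_row linear_sum; apply: eq_bigr => s' _.
  by rewrite linearZ /= mxE.
have : (b *m K)^T = 0.
  apply: homogeneous_kernel_neq0 => //; rewrite bK.
    by rewrite mulmx_sumr big1 // => s' _; rewrite -scalemxAr hK scaler0.
  by rewrite linear_sum -[RHS]hj; apply: eq_bigr => s' _; rewrite linearZ.
move/eqP; rewrite trmx_eq0 => /eqP bK0.
have : b = 0 by apply: (row_free_inj (row_base_free _)); rewrite bK0 mul0mx.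
by move/rowP/(_ s); rewrite !mxE.
Qed.

End NodeSpan.

Lemma dependency_double_sum (R : comPzRingType) (I : finType) (lam : I -> R) D :
  \sum_j lam j = 0 -> (forall l, \sum_j lam j * D j l = 0) ->
  \sum_j \sum_l lam j * lam l * (D j j - D j l - D l j + D l l) = 0.
Proof.
move=> lam0 D0.
have z1 : \sum_j \sum_l lam j * lam l * D j j = 0.
  apply: big1 => j _; under eq_bigr do rewrite mulrAC.
  by rewrite -mulr_sumr lam0 mulr0.
have z2 : \sum_j \sum_l lam j * lam l * D l j = 0.
  apply: big1 => j _; under eq_bigr do rewrite -mulrA.
  by rewrite -mulr_sumr D0 mulr0.
transitivity (\sum_j \sum_l lam j * lam l * D j j - \sum_j \sum_l lam j * lam l * D j l
    - \sum_j \sum_l lam j * lam l * D l j + \sum_j \sum_l lam j * lam l * D l l).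
  rewrite -!sumrB -big_split; apply: eq_bigr => j _.
  by rewrite -!sumrB -big_split; apply: eq_bigr => l _; rewrite /= mulrDr !mulrBr.
have z3 : \sum_j \sum_l lam j * lam l * D j l = 0.
  rewrite -[RHS]z2 exchange_big; apply: eq_bigr => j _; apply: eq_bigr => l _.
  by rewrite (mulrC (lam l)).
have z4 : \sum_j \sum_l lam j * lam l * D l l = 0.
  rewrite -[RHS]z1 exchange_big; apply: eq_bigr => j _; apply: eq_bigr => l _.
  by rewrite (mulrC (lam l)).
by rewrite z1 z2 z3 z4 !subr0 addr0.
Qed.

Section NodeDichotomy.
Variables (R : realType) (m n ne : nat) (G : sensing_graph n ne).
Variable p : 'cV[R]_(n * m).
Let z := relpos G p.

(** With more agents than dimensions, the agents affinely span the whole space: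
  otherwise an agent that is redundant in an affine dependency could move along
  the normal of the common hyperplane, against flex_single_agent.  Removing one
  agent then leaves enough of them to apply flex_single_agent to it. *)
Theorem incident_edges_span i (u : 'cV[R]_m) :
  (m = 2 \/ m = 3)%N -> (\rank (rigidity_matrix G z) + (3 * m - 3) = n * m)%N ->
  (m < n)%N ->
  (forall k, incident G i k -> dot (block z k) u = 0) -> u = 0.
Proof.
move=> hm hrank mn; apply: flex_single_agent => //.
set H := homogeneous p.
have drop1 : (\rank H <= \rank (homogeneous_but p i) + 1)%N.
  have -> : H = homogeneous_but p i + delta_mx i 0 *m row i H.
    apply/row_matrixP => j; rewrite linearD /= [row j (homogeneous_but _ _)]rowK row_mul.
    rewrite (_ : row j (delta_mx i 0) = (j == i)%:R%:M); last first.
      by apply/matrixP => a b; rewrite !ord1 !mxE eqxx andbT.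
    case: (eqVneq j i) => [->|_] /=; first by rewrite add0r mul_scalar_mx scale1r.
    by rewrite mul_scalar_mx scale0r addr0.
  apply: leq_trans (mxrank_add _ _) _; rewrite leq_add2l.
  exact: leq_trans (mxrankM_maxl _ _) (rank_leq_col _).
suff : (m < \rank H)%N by move=> ?; rewrite -(leq_add2r 1) (leq_trans _ drop1) // [leqLHS]addn1.
rewrite ltnNge; apply/negP => rH.
have [c cH c0] : exists2 c : 'rV_n, c *m H = 0 & c != 0.
  have [a Ha a0] : exists2 a : 'cV_n, H^T *m a = 0 & a != 0.
    by apply: dual_kernel; rewrite mxrank_tr (leq_ltn_trans rH).
  exists a^T; last by rewrite trmx_eq0.
  by apply: trmx_inj; rewrite trmx_mul trmxK trmx0.
have [j cj] : exists j, c 0 j != 0 by apply/rV0Pn.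
have HHj : (H <= homogeneous_but p j)%MS.
  apply/row_subP => r; have [->|rj] := eqVneq r j; last first.
    have -> : row r H = row r (homogeneous_but p j) by rewrite [RHS]rowK (negPf rj).
    exact: row_sub.
  have E : c 0 j *: row j H = - (c *m homogeneous_but p j).
    apply/eqP; rewrite -addr_eq0 -[X in _ == X]cH !mulmx_sum_row; apply/eqP.
    rewrite (bigD1 j) //= [RHS](bigD1 j) //= [row j (homogeneous_but _ _)]rowK eqxx scaler0 add0r.
    by congr (_ + _); apply: eq_bigr => l /negPf lj; rewrite [row l (homogeneous_but _ _)]rowK lj.
  rewrite -[row j H]scale1r -(mulVf cj) -scalerA E.
  by rewrite scalemx_sub // -mulNmx submxMl.
have [a Ha a0] : exists2 a : 'cV_(m + 1), H *m a = 0 & a != 0.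
  by apply: dual_kernel; rewrite [ltnRHS]addn1 ltnS.
have a'0 : usubmx a = 0.
  apply: (flex_single_agent (i := j) hm hrank).
    exact: leq_trans (homogeneous_rank_ge hm hrank mn) (mxrankS HHj).
  by move=> k _; exact: homogeneous_kernel.
have n0 : (0 < n)%N by apply: leq_ltn_trans mn.
by move: a0; rewrite (homogeneous_kernel_neq0 n0 Ha a'0) eqxx.
Qed.

Lemma sum_complete_graph (f : 'I_n -> 'I_n -> R) : complete_graph G ->
  (forall i j, f i j = f j i) -> (forall i, f i i = 0) ->
  \sum_i \sum_j f i j = 2 * \sum_k f (etail G k) (ehead G k).
Proof.
move=> cG fC f0.
pose e (x : 'I_ne * bool) : 'I_n * 'I_n :=
  if x.2 then (etail G x.1, ehead G x.1) else (ehead G x.1, etail G x.1).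
have eset x : [set (e x).1; (e x).2]%SET = [set etail G x.1; ehead G x.1]%SET.
  by rewrite /e; case: x.2 => //=; rewrite finset.setUC.
have einj : injective e.
  move=> [k b] [l c] E; have kl : k = l.
    by apply: (@edge_inj _ _ G); rewrite -(eset (k, b)) -(eset (l, c)) E.
  move: E; rewrite {}kl /e /=; have := etail_neq_ehead G l.
  by case: b; case: c => //= th [E1 E2]; move: th; rewrite E1 ?E2 eqxx.
rewrite pair_big /= (bigID (fun x : 'I_n * 'I_n => x.1 == x.2)) /=.
rewrite big1 => [|[i j] /= /eqP ->]; last by rewrite f0.
rewrite add0r (eq_bigl (mem (e @: [set: 'I_ne * bool]%SET))) => [|[i j]].
  rewrite (big_imset (fun x => f x.1 x.2)) /=; last by move=> ? ? _ _; exact: einj.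
  rewrite (eq_bigl predT) => [|x]; last by rewrite finset.in_setT.
  rewrite (eq_bigr (fun x => f (e (x.1, x.2)).1 (e (x.1, x.2)).2)); last by case.
  rewrite -(pair_bigA _ (fun k b => f (e (k, b)).1 (e (k, b)).2)) /= mulr_sumr.
  apply: eq_bigr => k _; rewrite big_bool /= [f (ehead G k) _]fC.
  by rewrite mulr2n mulrDl mul1r.
apply/idP/imsetP => /= [ij|[[k b] _]].
  have [k] := cG i j ij; move/setP => E.
  have := E (etail G k); have := E (ehead G k); have := etail_neq_ehead G k.
  rewrite !finset.in_set2 !eqxx !orbT => th /esym /orP[] /eqP hk /esym /orP[] /eqP tk.
  - by move: th; rewrite hk tk eqxx.
  - by exists (k, false); rewrite ?finset.in_setT // /e /= hk tk.
  - by exists (k, true); rewrite ?finset.in_setT // /e /= hk tk.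
  - by move: th; rewrite hk tk eqxx.
by have := etail_neq_ehead G k; rewrite /e; case: b => th [-> ->]; rewrite // eq_sym.
Qed.

(** In a complete graph an affine dependency c of the agents gives the
  self-stress c_i c_j on the edges.  Row independence of the rigidity matrix
  excludes self-stresses, hence affine dependencies, of which a dependency
  among the edges at one agent is an instance. *)
Theorem incident_edges_independent i (c : 'I_ne -> R) :
  complete_graph G -> (\rank (rigidity_matrix G z) = ne)%N ->
  \sum_(k | incident G i k) c k *: block z k = 0 ->
  forall k, incident G i k -> c k = 0.
Proof.
move=> cG hrank hc.
pose lam j := \sum_(k | incident G i k) incidence R G j k * c k.
have lam_sum : \sum_j lam j = 0.
  rewrite exchange_big big1 //= => k _.
  have h := sum_incidence G (fun=> c k : R^o) k.
  by rewrite subrr in h; exact: h.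
have lam_p : \sum_j lam j *: block p j = 0.
  rewrite -[RHS]hc; under eq_bigr do rewrite scaler_suml.
  rewrite exchange_big; apply: eq_bigr => k _ /=.
  rewrite /z block_relpos -(sum_incidence G (block p)) scaler_sumr.
  by apply: eq_bigr => j _; rewrite scalerA mulrC.
pose om : 'rV[R]_ne := \row_k (lam (etail G k) * lam (ehead G k)).
have om0 : om = 0.
  have rf : row_free (rigidity_matrix G z) by rewrite /row_free hrank.
  apply: (row_free_inj rf); rewrite mul0mx; apply: trmx_inj; rewrite trmx0 trmx_mul.
  set M := rigidity_matrix G z.
  suff dv v : dot v (M^T *m om^T) = 0 by apply: dotxx_eq0; exact: dv.
  rewrite dot_mulmx trmxK.
  pose f j l := lam j * lam l * dot (block p j - block p l) (block v j - block v l).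
  have : 2 * dot (M *m v) om^T = \sum_j \sum_l f j l.
    rewrite (sum_complete_graph (f := f)) //.
    - congr (_ * _); apply: eq_bigr => k _.
      by rewrite rigidityE /z block_relpos !mxE /f mulrC.
    - move=> j l; rewrite /f (mulrC (lam l)); congr (_ * _).
      by rewrite -[RHS]opprK -dotNl -dotNr !opprB.
    - by move=> j; rewrite /f subrr dot0l mulr0.
  have -> : \sum_j \sum_l f j l = 0; last by lra.
  rewrite -[RHS](dependency_double_sum (D := fun j l => dot (block p j) (block v l))
    lam_sum); last first.
    move=> l; transitivity (dot (\sum_j lam j *: block p j) (block v l)).
      by rewrite dot_suml; apply: eq_bigr => j _; rewrite dotZl.
    by rewrite lam_p dot0l.
  apply: eq_bigr => j _; apply: eq_bigr => l _.
  by rewrite /f dotBl !dotBr; congr (_ * _); ring.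
have lam2 j l : j != l -> lam j * lam l = 0.
  move=> jl; have [k /setP E] := cG j l jl.
  have := E j; have := E l; rewrite !finset.in_set2 !eqxx orbT /= => hl hj.
  have omk : lam (etail G k) * lam (ehead G k) = 0.
    by move/rowP/(_ k): om0; rewrite !mxE.
  case/orP: hj => /eqP Ej; case/orP: hl => /eqP El.
  - by move: jl; rewrite Ej El eqxx.
  - by rewrite Ej El.
  - by rewrite Ej El mulrC.
  - by move: jl; rewrite Ej El eqxx.
have lam0 j : lam j = 0.
  apply/eqP; rewrite -sqrf_eq0 expr2; apply/eqP.
  have : \sum_l lam j * lam l = 0 by rewrite -mulr_sumr lam_sum mulr0.
  rewrite (bigD1 j) //= [X in _ + X]big1 ?addr0 // => l lj.
  by apply: lam2; rewrite eq_sym.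
(* The edge k is the only one at agent i whose other end is j. *)
have other j k : incident G i k -> incident G j k -> j != i -> c k = 0.
  move=> ik jk ji; have := lam0 j; rewrite /lam (bigD1 k) //= big1 ?addr0.
    move/eqP; rewrite mulf_eq0 => /orP[|/eqP //]; rewrite mxE.
    move: jk; rewrite /incident ![_ == j]eq_sym => /orP[] ->; first by rewrite oner_eq0.
    by case: ifP; rewrite ?oner_eq0 ?oppr_eq0 ?oner_eq0.
  move=> l /andP[il lk]; rewrite mxE.
  have [jl|jl] := boolP (incident G j l); last first.
    move: jl; rewrite /incident negb_or ![_ == j]eq_sym => /andP[/negPf -> /negPf ->].
    by rewrite mul0r.
  have ends q : incident G i q -> incident G j q ->
      [set etail G q; ehead G q]%SET = [set i; j]%SET.
    rewrite /incident => /orP[] /eqP iq /orP[] /eqP jq.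
    - by move: ji; rewrite -iq -jq eqxx.
    - by rewrite iq jq.
    - by rewrite iq jq finset.setUC.
    - by move: ji; rewrite -iq -jq eqxx.
  by move: lk; rewrite (@edge_inj _ _ G l k) ?eqxx // !ends.
move=> k ik; have := etail_neq_ehead G k.
have [ti|ti] := eqVneq (etail G k) i.
  by move=> th; apply: (other (ehead G k)); rewrite /incident ?eqxx ?orbT // -ti eq_sym.
by move=> _; apply: (other (etail G k)); rewrite // /incident eqxx.
Qed.

End NodeDichotomy.

Lemma complete_graph_count n ne (G : sensing_graph n ne) :
  ne = 'C(n, 2) -> complete_graph G.
Proof.
move=> hne i j ij.
pose E := [set [set etail G k; ehead G k]%SET | k : 'I_ne]%SET.
pose P := [set A : {set 'I_n} | #|A| == 2]%SET.
have EP : E = P.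
  apply/eqP; rewrite eqEcard; apply/andP; split.
    apply/fintype.subsetP => A /imsetP[k _ ->].
    by rewrite finset.inE cards2 etail_neq_ehead.
  rewrite card_draws card_ord card_imset ?card_ord -?hne //.
  exact: edge_inj.
have : [set i; j]%SET \in E by rewrite EP finset.inE cards2 ij.
by case/imsetP => k _ ->; exists k.
Qed.

(** * Transversality of the desired shape *)

Section Transversality.
Variables (R : realType) (K N L : nat) (A : {linear 'cV[R]_K -> 'M[R]_(N, L)}).

Lemma transverse_adjoint_injective z0 :
  (forall v : 'cV_N, (A z0)^T *m v = 0 -> v = 0) ->
  exists2 C0 : R, 0 < C0 & forall rho0, transverse A C0 rho0 z0.
Proof.
move=> /injective_bounded_below[C C0 hC]; exists C => // rho0 z g v _.
apply: le_trans (abs_dot_le _ _) _; rewrite ler_wpM2r ?enorm_ge0 //.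
rewrite (le_trans (hC v)) // ler_wpM2l ?(ltW C0) // lerDl.
by rewrite mulr_ge0 ?enorm_ge0.
Qed.

Lemma injective_nearby z0 : (forall g : 'cV_L, A z0 *m g = 0 -> g = 0) ->
  exists C rho : R, [/\ 0 < C, 0 < rho & forall z (g : 'cV_L),
    enorm (z - z0) <= rho -> enorm g <= C * enorm (A z *m g)].
Proof.
move=> /injective_bounded_below[C C0 hC].
have [D D0 hD] := bilinear_bounded A.
exists (2 * C), (2 * (C * D))^-1; split => [||z g hz].
- by rewrite mulr_gt0.
- by rewrite invr_gt0 !mulr_gt0.
have E : A z0 *m g = A z *m g - A (z - z0) *m g.
  by rewrite -mulmxBl -linearB /= opprB addrC subrK.
have h : enorm g <= C * enorm (A z *m g) + enorm g / 2.
  apply: le_trans (hC g) _; rewrite E.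
  apply: (@le_trans _ _ (C * (enorm (A z *m g) + D * enorm (z - z0) * enorm g))).
    by rewrite ler_wpM2l ?(ltW C0) // (le_trans (ler_enormB _ _)) // lerD2l.
  rewrite mulrDr lerD2l.
  apply: (@le_trans _ _ (C * D * (2 * (C * D))^-1 * enorm g)).
    rewrite [leLHS](_ : _ = C * D * enorm (z - z0) * enorm g); last by ring.
    by rewrite ler_wpM2r ?enorm_ge0 // ler_wpM2l // ltW // mulr_gt0.
  rewrite (_ : C * D * _ = 2^-1) 1?mulrC //; field.
  by rewrite !gt_eqF.
lra.
Qed.

(** The work v . A(z) g is the transpose of A(z) applied to v, paired with g,
  and g is controlled by the force. *)
Lemma transverse_injective z0 : (forall g : 'cV_L, A z0 *m g = 0 -> g = 0) ->
  exists C0 rho0 : R, [/\ 0 < C0, 0 < rho0 & transverse A C0 rho0 z0].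
Proof.
move=> /injective_nearby[C [rho [C0 rho0 hC]]].
have [D D0 hD] := adjoint_bounded A.
exists ((1 + D) * C), rho; split => [||z g v hz] //; first by rewrite mulr_gt0 // ltr_wpDl.
rewrite dot_mulmx.
have E : (A z)^T *m v = (A z0)^T *m v + (A (z - z0))^T *m v.
  by rewrite -mulmxDl -linearD /= -linearD /= addrC subrK.
have h : enorm ((A z)^T *m v) <=
    (1 + D) * (enorm ((A z0)^T *m v) + enorm (z - z0) * enorm v).
  have := hD (z - z0) v; have := ler_enormD ((A z0)^T *m v) ((A (z - z0))^T *m v).
  rewrite -E; have := mulr_ge0 (ltW D0) (enorm_ge0 ((A z0)^T *m v)).
  by have := mulr_ge0 (enorm_ge0 (z - z0)) (enorm_ge0 v); lra.
apply: le_trans (abs_dot_le _ _) _.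
apply: (@le_trans _ _ ((1 + D) * (enorm ((A z0)^T *m v) + enorm (z - z0) * enorm v)
  * (C * enorm (A z *m g)))).
  by rewrite ler_pM ?enorm_ge0 // hC.
by rewrite le_eqVlt; apply/orP; left; apply/eqP; ring.
Qed.

End Transversality.

Section Gain.
Variables (R : realType) (m n ne : nat) (G : sensing_graph n ne).
Implicit Types (z : 'cV[R]_(ne * m)) (v : 'cV[R]_(n * m)) (Q : 'M[R]_m).

(** The gain acts on the pair of the error divided by the square root of two and
  the estimation mismatch; with this weight the equation of motion of the pair
  is the transpose of its force. *)
Definition gain z : 'M[R]_(n * m, ne + ne) :=
  row_mx (Num.sqrt 2 *: (kron_id m (incidence R G) *m blockdiag z))
         (kron_id m (incidence_tail R G) *m blockdiag z).

Lemma blockdiag_linear a z z' :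
  blockdiag (a *: z + z') = a *: blockdiag z + blockdiag z' :> 'M[R]_(ne * m, ne).
Proof. by apply/matrixP => r j; rewrite !mxE; case: eqP; rewrite ?mulr0 ?addr0. Qed.

Fact gain_is_linear : linear gain.
Proof.
move=> a z z'; rewrite /gain blockdiag_linear !mulmxDr -!scalemxAr scalerDr.
by rewrite scalerA mulrC -scalerA scale_row_mx add_row_mx.
Qed.
HB.instance Definition _ := GRing.isLinear.Build R _ _ _ gain gain_is_linear.

Let s2 : R := Num.sqrt 2.
Let s2_neq0 : s2 != 0. Proof. by rewrite gt_eqF // sqrtr_gt0. Qed.

Lemma block_gain z (a b : 'cV[R]_ne) i :
  block (gain z *m col_mx a b) i =
  \sum_k (s2 * incidence R G i k * a k 0 + (i == etail G k)%:R * b k 0) *: block z k.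
Proof.
rewrite mul_row_col blockD -scalemxAl blockZ block_incidence_diag block_tail_diag.
rewrite scaler_sumr -big_split; apply: eq_bigr => k _ /=.
by rewrite scalerA -scalerDl mulrA.
Qed.

Lemma gain_trE z v : (gain z)^T *m v =
  col_mx (s2 *: (rigidity_matrix G z *m v))
         ((blockdiag z)^T *m (kron_id m (incidence_tail R G))^T *m v).
Proof. by rewrite /gain tr_row_mx mul_col_mx linearZ /= -scalemxAl !trmx_mul. Qed.

Lemma gain_adjoint_injective z :
  (forall i (u : 'cV[R]_m), (forall k, incident G i k -> dot (block z k) u = 0) -> u = 0) ->
  forall v, (gain z)^T *m v = 0 -> v = 0.
Proof.
move=> span v; rewrite gain_trE -col_mx0 => /eq_col_mx[hB hS].
apply: block_inj => i; rewrite block0; apply: (span i) => k.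
have tk : dot (block z k) (block v (etail G k)) = 0 by rewrite -tail_trE hS mxE.
have hk : dot (block z k) (block v (ehead G k)) = 0.
  have : (rigidity_matrix G z *m v) k 0 = 0.
    by move/eqP: hB; rewrite scaler_eq0 (negPf s2_neq0) => /eqP ->; rewrite mxE.
  by rewrite rigidityE dotBr tk sub0r => /eqP; rewrite oppr_eq0 => /eqP.
by rewrite /incident => /orP[] /eqP <-.
Qed.

Lemma gain_injective z :
  (forall i (c : 'I_ne -> R), \sum_(k | incident G i k) c k *: block z k = 0 ->
    forall k, incident G i k -> c k = 0) ->
  forall g : 'cV_(ne + ne), gain z *m g = 0 -> g = 0.
Proof.
move=> indep g; rewrite -[g]vsubmxK => h.
set a := usubmx g in h *; set b := dsubmx g in h *.
have hi i k : incident G i k ->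
    s2 * incidence R G i k * a k 0 + (i == etail G k)%:R * b k 0 = 0.
  apply: (indep i (fun k => s2 * incidence R G i k * a k 0
    + (i == etail G k)%:R * b k 0)) k.
  have : block (gain z *m col_mx a b) i = 0 by rewrite h block0.
  rewrite block_gain (bigID (incident G i)) /= [X in _ + X]big1 ?addr0 // => l.
  rewrite /incident negb_or ![_ == i]eq_sym => /andP[/negPf it /negPf ih].
  by rewrite mxE it ih mulr0 !mul0r addr0 scale0r.
have a0 k : a k 0 = 0.
  have := hi (ehead G k) k; rewrite /incident eqxx orbT => /(_ isT).
  rewrite mxE eqxx [ehead G k == _]eq_sym (negPf (etail_neq_ehead G k)) mul0r addr0.
  by move/eqP; rewrite mulrN1 mulNr oppr_eq0 mulf_eq0 (negPf s2_neq0) => /eqP.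
rewrite -col_mx0; congr col_mx; apply/colP => k; rewrite [RHS]mxE ?a0 //.
have := hi (etail G k) k; rewrite /incident eqxx => /(_ isT).
by rewrite a0 mulr0 add0r mul1r.
Qed.

Definition rotate l Q (x : 'cV[R]_(l * m)) : 'cV[R]_(l * m) :=
  tensmx (1%:M : 'M[R]_l) Q *m x.

Lemma block_rotate l Q (x : 'cV[R]_(l * m)) i : block (rotate Q x) i = Q *m block x i.
Proof. exact: block_tens1. Qed.

Lemma rotateK l Q Q' : Q' *m Q = 1%:M -> cancel (@rotate l Q) (rotate Q').
Proof. by move=> h x; apply: block_inj => i; rewrite !block_rotate mulmxA h mul1mx. Qed.

Lemma dot_rotate l Q (x y : 'cV[R]_(l * m)) :
  dot x (rotate Q y) = dot (rotate Q^T x) y.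
Proof. by rewrite !dot_block; apply: eq_bigr => i _; rewrite !block_rotate dot_mulmx. Qed.

Lemma enorm_rotate l Q (x : 'cV[R]_(l * m)) :
  Q^T *m Q = 1%:M -> enorm (rotate Q x) = enorm x.
Proof. by move=> h; rewrite !enormE dot_rotate rotateK. Qed.

Lemma rotateB l Q (x y : 'cV[R]_(l * m)) : rotate Q (x - y) = rotate Q x - rotate Q y.
Proof. exact: mulmxBr. Qed.

Lemma gain_rotate Q z (g : 'cV_(ne + ne)) : gain (rotate Q z) *m g = rotate Q (gain z *m g).
Proof.
apply: block_inj => i; rewrite block_rotate -[g]vsubmxK !block_gain mulmx_sumr.
by apply: eq_bigr => k _; rewrite block_rotate scalemxAr.
Qed.

Lemma gain_tr_rotate Q z v : (gain (rotate Q z))^T *m v = (gain z)^T *m rotate Q^T v.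
Proof.
rewrite !gain_trE; congr col_mx; last first.
  by apply/colP => k; rewrite !tail_trE !block_rotate dot_mulmx trmxK.
congr (_ *: _); apply/colP => k; rewrite !rigidityE !block_rotate.
by rewrite -mulmxBr dot_mulmx trmxK.
Qed.

Lemma transverse_rotate (C0 rho0 : R) z0 Q : Q *m Q^T = 1%:M ->
  transverse gain C0 rho0 z0 -> transverse gain C0 rho0 (rotate Q z0).
Proof.
move=> hQ tr z g v; have hQ' := mulmx1C hQ.
have hQt : Q^T^T *m Q^T = 1%:M by rewrite trmxK.
have [z' ->] : exists z', z = rotate Q z'.
  by exists (rotate Q^T z); rewrite rotateK.
rewrite -rotateB enorm_rotate // => hz.
rewrite gain_rotate dot_rotate enorm_rotate // gain_tr_rotate.
by rewrite -(enorm_rotate v hQt); exact: tr.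
Qed.

End Gain.

Section DesiredShape.
Variables (R : realType) (m n ne : nat) (G : sensing_graph n ne).
Variable pdes : 'cV[R]_(n * m).
Let zdes := relpos G pdes.
Hypothesis hn : (2 <= n)%N.
Hypothesis hrigid : inf_min_rigid G pdes.

Lemma rigid_rank : [/\ (m = 2 \/ m = 3)%N,
  (\rank (rigidity_matrix G zdes) + (3 * m - 3) = n * m)%N &
  \rank (rigidity_matrix G zdes) = ne].
Proof.
case: hrigid => [[[hm ->]|[hm ->]]] [[hm' ->]|[hm' ->]]; rewrite hm in hm' *;
  by [|split; [left|lia|]|split; [right|lia|]].
Qed.

Lemma rigid_span i (u : 'cV[R]_m) : (m < n)%N ->
  (forall k, incident G i k -> dot (block zdes k) u = 0) -> u = 0.
Proof. by have [hm hr _] := rigid_rank; move=> mn; exact: incident_edges_span. Qed.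

Lemma rigid_complete : m = n -> complete_graph G.
Proof.
move=> mn; apply: complete_graph_count.
case: hrigid => [_ [[hm ->]|[hm ->]]]; rewrite -mn hm; exact/eqP.
Qed.

(** With more agents than dimensions the edges at each agent span the space,
  and the transpose of the gain is injective.  Otherwise the agents are exactly
  as many as the dimensions, or there are only two of them in space and no edge;
  in the former case the graph is complete, the edges at each agent are
  independent, and the gain itself is injective.  Since rotations commute with
  the gain, one pair of constants serves all rotated copies. *)
Theorem transverse_desired : (0 < ne)%N -> exists C0 rho0 : R, [/\ 0 < C0, 0 < rho0 &
  forall Q : 'M[R]_m, Q *m Q^T = 1%:M ->
  transverse (@gain R m n ne G) C0 rho0 (rotate Q zdes)].
Proof.
move=> ne0; have [hm hr hne] := rigid_rank.
have [mn|nm] := ltnP m n.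
  have [|C0 C0p tr] := @transverse_adjoint_injective _ _ _ _ (@gain R m n ne G) zdes.
    by apply: gain_adjoint_injective => i u; exact: rigid_span.
  by exists C0, 1; split => // Q hQ; exact: transverse_rotate.
have mn : m = n.
  apply/eqP; rewrite eqn_leq nm andbT; move: hr ne0; rewrite hne.
  by case: hm => E; rewrite E; lia.
have [|C0 [rho0 [C0p rho0p tr]]] :=
    @transverse_injective _ _ _ _ (@gain R m n ne G) zdes.
  by apply: gain_injective => i c; apply: incident_edges_independent (rigid_complete mn) hne.
by exists C0, rho0; split => // Q hQ; exact: transverse_rotate.
Qed.

(** For triangles and tetrahedrons the gain is a square matrix, so injectivity
  of its transpose makes it invertible. *)
Theorem injective_desired : triangle m G \/ tetrahedron m G ->
  exists2 rho : R, 0 < rho & forall (Q : 'M[R]_m), Q *m Q^T = 1%:M ->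
  forall z, enorm (z - rotate Q zdes) <= rho ->
  forall g : 'cV_(ne + ne), gain G z *m g = 0 -> g = 0.
Proof.
move=> tt; have [hm hr hne] := rigid_rank.
have [mn nm2] : (m < n)%N /\ (n * m = ne + ne)%N.
  by case: tt => -[Em En _]; move: hr; rewrite hne Em En; lia.
have inj (g : 'cV_(ne + ne)) : gain G zdes *m g = 0 -> g = 0.
  have rf : row_free (gain G zdes).
    apply: inj_row_free => v hv; apply: trmx_inj; rewrite trmx0.
    apply: (gain_adjoint_injective (z := zdes)) => [i u|].
      exact: rigid_span.
    by rewrite -trmx_mul hv trmx0.
  have rf' : row_free (gain G zdes)^T.
    by rewrite /row_free mxrank_tr; move: rf; rewrite /row_free => /eqP ->; rewrite nm2.
  move=> h; apply: trmx_inj; rewrite trmx0; apply: (row_free_inj rf').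
  by rewrite -trmx_mul h trmx0 mul0mx.
have [C [rho [C0 rho0 hC]]] := injective_nearby (A := @gain R m n ne G) inj.
exists rho => // Q hQ z hz g hg.
have hQ' := mulmx1C hQ; have hQt : Q^T^T *m Q^T = 1%:M by rewrite trmxK.
apply: enorm_eq0; apply/eqP; rewrite eq_le enorm_ge0 andbT.
have := hC (rotate Q^T z) g; rewrite gain_rotate hg.
rewrite (_ : rotate Q^T z - zdes = rotate Q^T (z - rotate Q zdes)); last first.
  by rewrite rotateB [rotate Q^T (rotate Q _)]rotateK.
by rewrite enorm_rotate // /rotate mulmx0 enorm0 mulr0; exact.
Qed.

End DesiredShape.

Section Congruence.
Variables (R : realType) (m ne : nat) (G : sensing_graph m.+1 ne).
Implicit Types (p : 'cV[R]_(m.+1 * m)).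
Hypothesis cG : complete_graph G.

Lemma complete_edge i j : i != j -> exists k (s : R), s ^+ 2 = 1 /\
  forall p, block p i - block p j = s *: block (relpos G p) k.
Proof.
move=> ij; have [k /setP E] := cG ij; exists k.
have := E i; have := E j; rewrite !finset.in_set2 !eqxx orbT /=.
move=> /orP[] /eqP Ej /orP[] /eqP Ei.
- by move: ij; rewrite Ei Ej eqxx.
- exists (-1); rewrite sqrrN expr1n; split=> // p.
  by rewrite block_relpos scaleN1r opprB Ei Ej.
- exists 1; rewrite expr1n; split=> // p.
  by rewrite block_relpos scale1r Ei Ej.
- by move: ij; rewrite Ei Ej eqxx.
Qed.

Definition simplex p : 'M[R]_m :=
  \matrix_(b < m, a < m) (block p (lift ord0 a) - block p ord0) b 0.

Lemma col_simplex p a : col a (simplex p) = block p (lift ord0 a) - block p ord0.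
Proof. by apply/colP => b; rewrite !mxE. Qed.

Lemma gram_simplex p p0 :
  (forall k, enorm (block (relpos G p) k) = enorm (block (relpos G p0) k)) ->
  (simplex p)^T *m simplex p = (simplex p0)^T *m simplex p0.
Proof.
move=> he.
have dist i j : dot (block p i - block p j) (block p i - block p j) =
    dot (block p0 i - block p0 j) (block p0 i - block p0 j).
  have [->|ij] := eqVneq i j; first by rewrite !subrr !dot0r.
  have [k [s [_ hs]]] := complete_edge ij.
  by rewrite !hs !dotZl !dotZr -!enorm_sqr he.
have polar (x y : 'cV[R]_m) : dot x y = (dot x x + dot y y - dot (x - y) (x - y)) / 2.
  by rewrite dotBl !dotBr (dotC y x); field.
apply/matrixP => a b.
have E q : ((simplex q)^T *m simplex q) a b = dot (col a (simplex q)) (col b (simplex q)).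
  by rewrite mxE; apply: eq_bigr => c _; rewrite !mxE.
rewrite !E !col_simplex polar [RHS]polar.
have cancel0 (x y w : 'cV[R]_m) : x - w - (y - w) = x - y by rewrite opprB addrA subrK.
by rewrite !cancel0 !dist.
Qed.

(** Equal edge lengths give equal Gram matrices, hence an orthogonal matrix Q
  carrying one simplex to the other.  If det Q were -1, the composite of Q
  with the inverse of the nearby rotation would reverse some vector, and Q
  would not be near that rotation. *)
Theorem congruent_near p0 :
  (forall u : 'cV[R]_m,
    (forall k, incident G ord0 k -> dot (block (relpos G p0) k) u = 0) -> u = 0) ->
  exists2 rho : R, 0 < rho & forall p (Q0 : 'M[R]_m), rotation Q0 ->
  enorm (relpos G p - rotate Q0 (relpos G p0)) <= rho ->
  (forall k, enorm (block (relpos G p) k) = enorm (block (relpos G p0) k)) ->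
  desired_shape (relpos G p0) (relpos G p).
Proof.
move=> span.
have U : simplex p0 \in unitmx.
  rewrite -row_free_unit; apply: inj_row_free => c hc.
  apply: trmx_inj; rewrite trmx0; apply: span => k hk.
  have dc a : dot (block p0 (lift ord0 a) - block p0 ord0) c^T = 0.
    have := congr1 (fun M : 'rV_m => M 0 a) hc; rewrite !mxE => <-.
    by apply: eq_bigr => b _; rewrite !mxE mulrC.
  have th := etail_neq_ehead G k.
  rewrite block_relpos; case/orP: hk => /eqP E0; move: th; rewrite E0.
    case/unlift_some => a -> _.
    by rewrite -opprB dotNl dc oppr0.
  by rewrite eq_sym => /unlift_some[a -> _].
have [Cc Cc0 hCc] : exists2 C, 0 < C & forall x : 'cV_m,
    enorm x <= C * enorm (simplex p0 *m x).
  apply: injective_bounded_below => x hx.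
  by rewrite -(mulKmx U x) hx mulmx0.
exists (Cc * m.+1%:R)^-1; first by rewrite invr_gt0 mulr_gt0 // ltr0n.
move=> p Q0 [hQ0 dQ0] near he.
have hQ0' := mulmx1C hQ0.
pose Q := simplex p *m invmx (simplex p0).
have QC : Q *m simplex p0 = simplex p by rewrite /Q mulmxKV.
have QQ : Q^T *m Q = 1%:M.
  rewrite /Q trmx_mul -mulmxA [X in _ *m X]mulmxA (gram_simplex he).
  by rewrite !mulmxA -trmx_mul mulmxV // trmx1 mul1mx mulmxV.
have Qcol i : block p i - block p ord0 = Q *m (block p0 i - block p0 ord0).
  have [->|] := eqVneq i ord0; first by rewrite !subrr mulmx0.
  rewrite eq_sym => /unlift_some[a -> _].
  by rewrite -!col_simplex -QC; apply/colP => b; rewrite !mxE; apply: eq_bigr => c _; rewrite !mxE.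
exists Q; last first.
  apply: block_inj => k; rewrite block_tens1 !block_relpos.
  have via0 (q : 'cV[R]_(m.+1 * m)) i j : block q i - block q j
      = (block q i - block q ord0) - (block q j - block q ord0).
    by rewrite opprB addrA subrK.
  by rewrite via0 [in RHS]via0 mulmxBr -!Qcol.
split; first exact: mulmx1C.
have [//|d1] := eqVneq (\det Q) 1.
have dm1 : \det Q = -1.
  have : \det Q * \det Q = 1 by rewrite -[X in X * _]det_tr -det_mulmx QQ det1.
  by rewrite -expr2 => /eqP; rewrite sqrf_eq1 (negPf d1) => /eqP.
pose O := Q0^T *m Q.
have OO : O *m O^T = 1%:M.
  by rewrite /O trmx_mul trmxK mulmxA -(mulmxA Q0^T) (mulmx1C QQ) mulmx1.
have dO : \det (1%:M + O) = 0.
  have E : 1%:M + O = O *m (1%:M + O)^T.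
    by rewrite linearD /= trmx1 mulmxDr mulmx1 OO addrC.
  have : \det (1%:M + O) = - \det (1%:M + O).
    by rewrite {1}E det_mulmx det_tr /O det_mulmx det_tr dQ0 dm1 mul1r mulN1r.
  lra.
have [y' hy' y'0] : exists2 y' : 'cV_m, (1%:M + O) *m y' = 0 & y' != 0.
  apply: dual_kernel; rewrite ltn_neqAle rank_leq_col andbT.
  by apply/negP; rewrite -/(row_free _) row_free_unit unitmxE dO unitr0.
pose y := invmx (simplex p0) *m y'.
have y0 : y != 0.
  apply: contra y'0 => /eqP h; apply/eqP.
  by rewrite -(mulKVmx U y') -/y h mulmx0.
have Ey : (simplex p - Q0 *m simplex p0) *m y = - 2 *: (Q0 *m (simplex p0 *m y)).
  have h1 : simplex p *m y = Q *m y' by rewrite /y mulmxA.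
  have h2 : simplex p0 *m y = y' by rewrite /y mulKVmx.
  have h3 : Q *m y' = - (Q0 *m y').
    have : Q0 *m ((1%:M + O) *m y') = 0 by rewrite hy' mulmx0.
    rewrite mulmxDl mul1mx mulmxDr /O -mulmxA !mulmxA hQ0 mul1mx -mulmxA.
    by move/eqP; rewrite addrC addr_eq0 => /eqP.
  by rewrite mulmxBl -mulmxA h1 h2 h3 scaleNr scaler_nat mulr2n opprD.
have Ebound : enorm ((simplex p - Q0 *m simplex p0) *m y) <=
    m%:R * (Cc * m.+1%:R)^-1 * enorm y.
  have -> : (simplex p - Q0 *m simplex p0) *m y =
      \sum_a y a 0 *: col a (simplex p - Q0 *m simplex p0).
    by apply/colP => b; rewrite mxE summxE; apply: eq_bigr => a _; rewrite !mxE mulrC.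
  apply: le_trans (ler_enorm_sum _ _) _.
  rewrite -mulrA -[m in m%:R]card_ord -sumr_const mulr_suml; apply: ler_sum => a _.
  rewrite mul1r enormZ mulrC ler_pM ?enorm_ge0 ?coord_le_enorm //.
  have -> : col a (simplex p - Q0 *m simplex p0) =
      (block p (lift ord0 a) - block p ord0)
      - Q0 *m (block p0 (lift ord0 a) - block p0 ord0).
    by rewrite -!col_simplex; apply/colP => b; rewrite !mxE; congr (_ - _);
      apply: eq_bigr => c _; rewrite !mxE.
  have [k [s [s1 hs]]] := complete_edge (neq_lift ord0 a).
  rewrite -(opprB (block p ord0)) -(opprB (block p0 ord0)) !hs.
  rewrite mulmxN opprK addrC -scalemxAr -scalerBr enormZ.
  have -> : `|s| = 1 by apply/eqP; rewrite -sqrp_eq1 // real_normK ?num_real // s1.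
  rewrite mul1r -block_rotate -blockB.
  by rewrite (le_trans (enorm_block_le _ _)) // enormB.
have yy := hCc y.
have Qn : enorm (Q0 *m (simplex p0 *m y)) = enorm (simplex p0 *m y).
  by rewrite !enormE dot_mulmx mulmxA hQ0' mul1mx.
move: Ebound; rewrite Ey enormZ Qn normrN ger0_norm // => Ebound.
have yp : 0 < enorm y.
  rewrite lt_def enorm_ge0 andbT; apply: contra y0 => /eqP h.
  by apply/eqP/enorm_eq0.
have : Cc * (2 * enorm (simplex p0 *m y)) <= enorm y.
  apply: le_trans (ler_wpM2l (ltW Cc0) Ebound) _.
  rewrite (_ : _ * _ = (m%:R / m.+1%:R) * enorm y); last first.
    by rewrite invfM (mulrCA m%:R) !mulrA mulfV ?gt_eqF // mul1r.
  rewrite ler_piMl ?enorm_ge0 // ler_pdivrMr ?ltr0n // mul1r ler_nat //.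
lra.
Qed.

End Congruence.

(** * Limits of trajectories *)

Section Limits.
Variable R : realType.

Definition vcvg k (x : R -> 'cV[R]_k) (l : 'cV[R]_k) : Prop :=
  forall i, x t i 0 @[t --> +oo] --> (l i 0 : R).

Lemma vcvg_cst k (l : 'cV[R]_k) : vcvg (fun=> l) l.
Proof. by move=> i; exact: cvg_cst. Qed.

Lemma vcvg_ext k (x y : R -> 'cV[R]_k) l :
  (forall t, 0 <= t -> x t = y t) -> vcvg x l -> vcvg y l.
Proof.
move=> xy hx i; apply: cvg_trans (hx i); apply: near_eq_cvg.
by near=> t; rewrite xy //; near: t; exact: nbhs_pinfty_ge.
Unshelve. all: by end_near. Qed.

Lemma vcvg_unique k (x : R -> 'cV[R]_k) l l' : vcvg x l -> vcvg x l' -> l = l'.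
Proof.
move=> h h'; apply/colP => i.
exact: (cvg_unique (@norm_hausdorff R R) (h i) (h' i)).
Qed.

Lemma cvg_fsum I (r : seq I) (f : I -> R -> R) (l : I -> R) :
  (forall i, f i t @[t --> +oo] --> l i) ->
  (\sum_(i <- r) f i t) @[t --> +oo] --> \sum_(i <- r) l i.
Proof.
move=> h; elim: r => [|i r ih].
  rewrite big_nil (_ : (fun t => _) = fun=> 0); first exact: cvg_cst.
  by apply/funext => t; rewrite big_nil.
rewrite big_cons (_ : (fun t => _) = fun t => f i t + \sum_(j <- r) f j t).
  exact: cvgD.
by apply/funext => t; rewrite big_cons.
Qed.

Lemma vcvgD k (x y : R -> 'cV[R]_k) l l' :
  vcvg x l -> vcvg y l' -> vcvg (fun t => x t + y t) (l + l').
Proof.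
move=> hx hy i; rewrite mxE (_ : (fun t => _) = fun t => x t i 0 + y t i 0).
  exact: cvgD.
by apply/funext => t; rewrite mxE.
Qed.

Lemma vcvgN k (x : R -> 'cV[R]_k) l : vcvg x l -> vcvg (fun t => - x t) (- l).
Proof.
move=> hx i; rewrite mxE (_ : (fun t => _) = fun t => - x t i 0).
  exact: cvgN.
by apply/funext => t; rewrite mxE.
Qed.

Lemma vcvgB k (x y : R -> 'cV[R]_k) l l' :
  vcvg x l -> vcvg y l' -> vcvg (fun t => x t - y t) (l - l').
Proof. by move=> hx /vcvgN; exact: vcvgD. Qed.

Lemma vcvg_mulmx k q (A : R -> 'M[R]_(q, k)) (A0 : 'M[R]_(q, k)) x l :
  (forall i j, A t i j @[t --> +oo] --> (A0 i j : R)) -> vcvg x l ->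
  vcvg (fun t => A t *m x t) (A0 *m l).
Proof.
move=> hA hx i; rewrite mxE.
rewrite (_ : (fun t => _) = fun t => \sum_j A t i j * x t j 0).
  by apply: cvg_fsum => j; exact: cvgM.
by apply/funext => t; rewrite mxE.
Qed.

Lemma cvg_linear_mx K q k (A : {linear 'cV[R]_K -> 'M[R]_(q, k)}) z l :
  vcvg z l -> forall i j, A (z t) i j @[t --> +oo] --> (A l i j : R).
Proof.
move=> hz i j.
have E (z' : 'cV[R]_K) : A z' i j = \sum_a z' a 0 * A (delta_mx a 0) i j.
  rewrite {1}(colE_delta z') linear_sum summxE; apply: eq_bigr => a _.
  by rewrite linearZ /= mxE.
rewrite E (_ : (fun t => _) = fun t => \sum_a z t a 0 * A (delta_mx a 0) i j).
  by apply: cvg_fsum => a; apply: cvgM; [exact: hz | exact: cvg_cst].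
by apply/funext => t; rewrite E.
Qed.

Lemma vcvg_bilinear K q k (A : {linear 'cV[R]_K -> 'M[R]_(q, k)}) z g lz lg :
  vcvg z lz -> vcvg g lg -> vcvg (fun t => A (z t) *m g t) (A lz *m lg).
Proof. by move=> hz hg; apply: vcvg_mulmx => //; exact: cvg_linear_mx. Qed.

Lemma cvg_dot k (x y : R -> 'cV[R]_k) l l' :
  vcvg x l -> vcvg y l' -> dot (x t) (y t) @[t --> +oo] --> (dot l l' : R).
Proof. by move=> hx hy; apply: cvg_fsum => i; exact: cvgM. Qed.

Lemma vcvg_derive_eq0 k (x d : R -> 'cV[R]_k) l d0 :
  (forall t, 0 <= t -> vderive x t (d t)) -> vcvg x l -> vcvg d d0 -> d0 = 0.
Proof.
move=> hx xl dd; apply/colP => i; rewrite mxE.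
exact: (derive_limit_eq0 (fun t t0 => hx t t0 i) (xl i) (dd i)).
Qed.

Lemma vderive_col_mx k l (x : R -> 'cV[R]_k) (y : R -> 'cV[R]_l) t dx dy :
  vderive x t dx -> vderive y t dy ->
  vderive (fun s => col_mx (x s) (y s)) t (col_mx dx dy).
Proof.
move=> hx hy i; rewrite -[i]splitK; case: (fintype.split i) => j /=.
  rewrite col_mxEu (_ : (fun s => _) = fun s => x s j 0); first exact: hx.
  by apply/funext => s; rewrite col_mxEu.
rewrite col_mxEd (_ : (fun s => _) = fun s => y s j 0); first exact: hy.
by apply/funext => s; rewrite col_mxEd.
Qed.

Lemma vcvg_col_mx k l (x : R -> 'cV[R]_k) (y : R -> 'cV[R]_l) lx ly :
  vcvg x lx -> vcvg y ly -> vcvg (fun s => col_mx (x s) (y s)) (col_mx lx ly).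
Proof.
move=> hx hy i; rewrite -[i]splitK; case: (fintype.split i) => j /=.
  rewrite col_mxEu (_ : (fun s => _) = fun s => x s j 0); first exact: hx.
  by apply/funext => s; rewrite col_mxEu.
rewrite col_mxEd (_ : (fun s => _) = fun s => y s j 0); first exact: hy.
by apply/funext => s; rewrite col_mxEd.
Qed.

Lemma exponential_cvg0 (f : R -> R) c C : 0 < c ->
  (forall t, 0 <= t -> `|f t| <= C * expR (- c * t)) -> f t @[t --> +oo] --> (0 : R).
Proof.
move=> c0 h; apply/cvgr0Pnorm_lt => e e0.
have C0 : 0 <= C by have := h 0 (lexx 0); rewrite mulr0 expR0 mulr1; exact: le_trans.
near=> t.
have t0 : 0 <= t by near: t; exact: nbhs_pinfty_ge.
apply: le_lt_trans (h t t0) _.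
have ct : C / e < c * t.
  rewrite -ltr_pdivrMl //; near: t.
  by apply: nbhs_pinfty_gt; exact: num_real.
rewrite mulNr expRN ltr_pdivrMr ?expR_gt0 //.
rewrite mulrC -ltr_pdivrMr // (lt_trans ct) //.
by have := expR_ge1Dx (c * t); lra.
Unshelve. all: by end_near. Qed.

End Limits.

(** * The closed loop *)

Section System.
Variables (R : realType) (m n ne : nat) (G : sensing_graph n ne).
Variables (zdes : 'cV[R]_(ne * m)) (mu : 'cV[R]_ne).
Implicit Types (x y : state R m n ne).

Let s2 : R := Num.sqrt 2.
Let s2_neq0 : s2 != 0. Proof. by rewrite gt_eqF // sqrtr_gt0. Qed.
Let s2s2 : s2 * s2 = 2. Proof. by rewrite -expr2 sqr_sqrtr. Qed.

Definition feedback x : 'cV[R]_(ne + ne) := col_mx (s2^-1 *: err x) (mu - est x).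

Definition force x : 'cV[R]_(n * m) := gain G (rpos x) *m feedback x.

Lemma vel_vector_field x : vel (vector_field G mu x) = - vel x - force x.
Proof.
rewrite /force /feedback mul_row_col -scalemxAl -scalemxAr scalerA mulfV //.
by rewrite scale1r opprD addrA.
Qed.

Lemma gain_adjoint_vel x : (gain G (rpos x))^T *m vel x =
  col_mx (s2^-1 *: err (vector_field G mu x)) (- est (vector_field G mu x)).
Proof.
rewrite gain_trE /= /estimator_input opprK scalerA; congr col_mx.
by congr (_ *: _); rewrite -[X in _ = _ * X]s2s2 mulrA mulVf // mul1r.
Qed.

Lemma enorm_feedback x :
  enorm (feedback x) ^+ 2 = enorm (err x) ^+ 2 / 2 + enorm (mu - est x) ^+ 2.
Proof.
rewrite enorm_col_mx enormZ exprMn real_normK ?num_real // exprVn sqr_sqrtr //.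
by rewrite mulrC.
Qed.

Lemma solution_flow T (x : R -> state R m n ne) : solution G zdes mu T x ->
  flow (@gain R m n ne G) (kron_id m (incidence R G))^T T
    (fun t => vel (x t)) (fun t => rpos (x t)) (fun t => feedback (x t)).
Proof.
move=> sol t t0 tT.
have [_ [_ /is_derive_vderive dv /is_derive_vderive dz
  /is_derive_vderive de /is_derive_vderive dm]] := sol t t0 tT.
split; [by apply: vderive_eq dv _; rewrite vel_vector_field | exact: dz |].
apply: vderive_eq (vderive_col_mx (vderiveZ _ de) (vderiveB (vderive_cst mu t) dm)) _.
by rewrite gain_adjoint_vel sub0r.
Qed.

Lemma equilibriumP x :
  equilibrium G zdes mu x <-> [/\ consistent G zdes x, vel x = 0 & force x = 0].
Proof.
split=> [[cx h]|[cx hv hF]].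
  have v0 : vel x = 0 by have := congr1 (@pos _ _ _ _) h.
  split=> //; have := congr1 (@vel _ _ _ _) h; rewrite vel_vector_field v0 /=.
  by rewrite oppr0 sub0r => /eqP; rewrite oppr_eq0 => /eqP.
split=> //; have := vel_vector_field x; rewrite hv hF oppr0 addr0.
rewrite /vector_field /= hv /estimator_input => ->.
by rewrite !mulmx0 scaler0 oppr0.
Qed.

Lemma pos_le_sdist x y : enorm (pos x - pos y) <= sdist x y.
Proof.
rewrite -[leLHS](ger0_norm (enorm_ge0 _)) -sqrtr_sqr ler_sqrt ?addr_ge0 ?sqr_ge0 //.
by rewrite -!addrA lerDl ?addr_ge0 ?sqr_ge0.
Qed.

Lemma vel_le_sdist x y : enorm (vel x - vel y) <= sdist x y.
Proof.
rewrite -[leLHS](ger0_norm (enorm_ge0 _)) -sqrtr_sqr ler_sqrt ?addr_ge0 ?sqr_ge0 //.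
by rewrite -!addrA addrCA lerDl ?addr_ge0 ?sqr_ge0.
Qed.

Lemma rpos_le_sdist x y : enorm (rpos x - rpos y) <= sdist x y.
Proof.
rewrite -[leLHS](ger0_norm (enorm_ge0 _)) -sqrtr_sqr ler_sqrt ?addr_ge0 ?sqr_ge0 //.
by rewrite -2!addrA addrC -addrA lerDl ?addr_ge0 ?sqr_ge0.
Qed.

Lemma err_le_sdist x y : enorm (err x - err y) <= sdist x y.
Proof.
rewrite -[leLHS](ger0_norm (enorm_ge0 _)) -sqrtr_sqr ler_sqrt ?addr_ge0 ?sqr_ge0 //.
by rewrite -addrA addrC -addrA lerDl ?addr_ge0 ?sqr_ge0.
Qed.

Lemma est_le_sdist x y : enorm (est x - est y) <= sdist x y.
Proof.
rewrite -[leLHS](ger0_norm (enorm_ge0 _)) -sqrtr_sqr ler_sqrt ?addr_ge0 ?sqr_ge0 //.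
by rewrite lerDr ?addr_ge0 ?sqr_ge0.
Qed.

Lemma sdist_ge0 x y : 0 <= sdist x y. Proof. exact: sqrtr_ge0. Qed.

Lemma sdist_le_sum x y : sdist x y <= enorm (pos x - pos y) + enorm (vel x - vel y)
  + enorm (rpos x - rpos y) + enorm (err x - err y) + enorm (est x - est y).
Proof.
have tri (a b : R) : 0 <= a -> 0 <= b -> Num.sqrt (a ^+ 2 + b ^+ 2) <= a + b.
  move=> a0 b0; rewrite -[leRHS]ger0_norm ?addr_ge0 // -sqrtr_sqr ler_sqrt ?sqr_ge0 //.
  by have := mulr_ge0 a0 b0; lra.
have step (s b c : R) : 0 <= s -> Num.sqrt s <= b -> 0 <= c ->
    Num.sqrt (s + c ^+ 2) <= b + c.
  move=> s0 sb c0; have := tri _ _ (sqrtr_ge0 s) c0; rewrite sqr_sqrtr // => h.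
  by apply: le_trans h _; rewrite lerD2r.
rewrite /sdist; do 3 (apply: (step); rewrite ?enorm_ge0 ?addr_ge0 ?sqr_ge0 //).
by apply: (tri); exact: enorm_ge0.
Qed.

Lemma feedback_lipschitz x y : enorm (feedback x - feedback y) <= 2 * sdist x y.
Proof.
have s2_ge1 : 1 <= s2 by rewrite -[1]sqrtr1 ler_sqrt // ler1n.
rewrite /feedback opp_col_mx add_col_mx (le_trans (col_mx_le_enorm _ _)) //.
rewrite mulr2n mulrDl mul1r lerD //.
  rewrite -scalerBr enormZ (le_trans _ (err_le_sdist x y)) //.
  by rewrite ler_piMl ?enorm_ge0 // ger0_norm ?invr_ge0 ?invf_le1 //; lra.
by rewrite opprB addrC addrA subrK enormB est_le_sdist.
Qed.

Lemma converges_vcvg (x : R -> state R m n ne) y : converges x y ->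
  [/\ vcvg (fun t => pos (x t)) (pos y), vcvg (fun t => vel (x t)) (vel y),
      vcvg (fun t => rpos (x t)) (rpos y), vcvg (fun t => err (x t)) (err y) &
      vcvg (fun t => est (x t)) (est y)].
Proof.
move=> cx; have gen k (f : state R m n ne -> 'cV[R]_k) :
    (forall x y, enorm (f x - f y) <= sdist x y) -> vcvg (fun t => f (x t)) (f y).
  move=> hf i; apply/cvgrPdist_lt => e e0.
  have /cvgr0Pnorm_lt/(_ e e0) := cx; apply: filterS => t.
  rewrite ger0_norm ?sdist_ge0 //; apply: le_lt_trans.
  rewrite distrC (le_trans _ (hf _ _)) //.
  by have := coord_le_enorm (f (x t) - f y) i; rewrite !mxE.
split; apply: gen.
- exact: pos_le_sdist.
- exact: vel_le_sdist.
- exact: rpos_le_sdist.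
- exact: err_le_sdist.
- exact: est_le_sdist.
Qed.

Lemma errorE z k :
  error zdes z k 0 = dot (block z k) (block z k) - dot (block zdes k) (block zdes k).
Proof. by rewrite mxE !enorm_sqr. Qed.

Lemma vcvg_feedback (x : R -> state R m n ne) y : converges x y ->
  vcvg (fun t => feedback (x t)) (feedback y).
Proof.
move=> /converges_vcvg[_ _ _ ce cm]; apply: vcvg_col_mx.
  move=> i; rewrite mxE (_ : (fun t => _) = fun t => s2^-1 * err (x t) i 0).
    by apply: cvgM; [exact: cvg_cst | exact: ce].
  by apply/funext => t; rewrite mxE.
by apply: vcvgB => //; exact: vcvg_cst.
Qed.

(** Along a convergent trajectory each velocity tends to its value at the
  limit, which is therefore zero. *)
Theorem limit_equilibrium (x : R -> state R m n ne) y :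
  solution G zdes mu +oo%E x -> converges x y -> equilibrium G zdes mu y.
Proof.
move=> sol cx; have cg := vcvg_feedback cx.
have [cp cv cz ce cm] := converges_vcvg cx.
have sol' t : 0 <= t -> _ := fun t0 => sol t t0 (ltry t).
have fl := solution_flow sol.
apply/equilibriumP.
have v0 : vel y = 0.
  apply: (vcvg_derive_eq0 (x := fun t => pos (x t)) _ cp cv) => t t0.
  by have [_ [/is_derive_vderive + _ _ _ _]] := sol' t t0.
have F0 : force y = 0.
  have : - vel y - force y = 0.
    apply: (vcvg_derive_eq0 (x := fun t => vel (x t))
      (d := fun t => - vel (x t) - force (x t)) _ cv).
      by move=> t t0; have [] := fl t t0 (ltry t).
    by apply: vcvgB; [exact: vcvgN | exact: vcvg_bilinear].
  by rewrite v0 oppr0 sub0r => /eqP; rewrite oppr_eq0 => /eqP.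
split=> //; split.
  apply: (vcvg_unique cz); apply: (vcvg_ext (x := fun t => relpos G (pos (x t)))).
    by move=> t t0; have [[]] := sol' t t0.
  by apply: vcvg_mulmx cp => i j; exact: cvg_cst.
apply: (vcvg_unique ce); apply: (vcvg_ext (x := fun t => error zdes (rpos (x t)))).
  by move=> t t0; have [[]] := sol' t t0.
have cb k : vcvg (fun t => block (rpos (x t)) k) (block (rpos y) k).
  move=> a; rewrite mxE (_ : (fun t => _) = fun t => rpos (x t) (mxtens_index (k, a)) 0).
    exact: cz.
  by apply/funext => t; rewrite mxE.
move=> k; rewrite errorE.
rewrite (_ : (fun t => _) = fun t => dot (block (rpos (x t)) k) (block (rpos (x t)) k)
    - dot (block zdes k) (block zdes k)).
  by apply: cvgB; [exact: cvg_dot | exact: cvg_cst].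
by apply/funext => t; rewrite errorE.
Qed.

(** The power of the force on the agents and that of the agents on the error
  and the estimator cancel, so that the total energy decreases. *)
Theorem energy_bound (x : R -> state R m n ne) y :
  solution G zdes mu +oo%E x -> converges x y ->
  enorm (err y) ^+ 2 <= 2 * enorm (mu - est (x 0)) ^+ 2 + 2 * enorm (vel (x 0)) ^+ 2
              + enorm (err (x 0)) ^+ 2.
Proof.
move=> sol cx; have cg := vcvg_feedback cx; have fl := solution_flow sol.
pose V t := dot (vel (x t)) (vel (x t)) + dot (feedback (x t)) (feedback (x t)).
have Vle t : 0 <= t -> V t <= V 0.
  move=> t0; apply: (nonincreasing_of_derive t0 (df := fun s =>
    (dot (- vel (x s) - force (x s)) (vel (x s))
     + dot (vel (x s)) (- vel (x s) - force (x s)))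
    + (dot ((gain G (rpos (x s)))^T *m vel (x s)) (feedback (x s))
     + dot (feedback (x s)) ((gain G (rpos (x s)))^T *m vel (x s))))).
    move=> s /andP[s0 _]; have [dv _ dg] := fl s s0 (ltry s).
    exact: is_deriveD (is_derive_dot dv dv) (is_derive_dot dg dg).
  move=> s _; rewrite -dot_mulmx -/(force _) [dot (feedback _) _]dotC -dot_mulmx.
  rewrite -/(force _) [dot (_ - _) _]dotC !dotBr !dotNr.
  by have := dotxx_ge0 (vel (x s)); lra.
have : dot (feedback y) (feedback y) <= V 0.
  apply: (cvgr_to_le (cvg_dot cg cg)); near=> t.
  apply: le_trans (Vle t _); last by near: t; exact: nbhs_pinfty_ge.
  by rewrite /V lerDr dotxx_ge0.
rewrite /V -!enorm_sqr !enorm_feedback.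
by have := sqr_ge0 (enorm (mu - est y)); lra.
Unshelve. all: by end_near. Qed.

End System.

(** * Trapping near the desired shape *)

Section Trapping.
Variables (R : realType) (m n ne : nat) (G : sensing_graph n ne).
Variables (pdes : 'cV[R]_(n * m)) (mu : 'cV[R]_ne).
Let zdes := relpos G pdes.
Hypothesis hn : (2 <= n)%N.
Hypothesis hrigid : inf_min_rigid G pdes.
Hypothesis hne : (0 < ne)%N.
Implicit Types (x y : state R m n ne) (Q : 'M[R]_m).

Definition near_copy r Q x := [/\ enorm (rpos x - rotate Q zdes) <= r,
  enorm (vel x) <= r & enorm (est x - mu) <= r].

Lemma near_desired_copy r x : near_desired zdes mu r x ->
  exists2 Q, rotation Q & near_copy r Q x.
Proof. by case=> -[z [Q hQ ->] hz] hv he; exists Q => //; split; exact: ltW. Qed.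

Lemma enorm_rotate_des Q : Q *m Q^T = 1%:M -> enorm (rotate Q zdes) = enorm zdes.
Proof. by move=> hQ; apply: enorm_rotate; exact: mulmx1C. Qed.

Lemma error_small r Q x : Q *m Q^T = 1%:M -> consistent G zdes x -> r <= 1 ->
  enorm (rpos x - rotate Q zdes) <= r ->
  enorm (err x) <= ne%:R * (2 * enorm zdes + 1) * r.
Proof.
move=> hQ [_ he] r1 hz; rewrite (le_trans (enorm_le_sum _)) //.
rewrite -mulrA -[ne in ne%:R]card_ord -sumr_const mulr_suml ler_sum // => k _.
rewrite mul1r he errorE; set z := rpos x.
set w := block (rotate Q zdes) k.
have ww : dot w w = dot (block zdes k) (block zdes k).
  by rewrite /w block_rotate dot_mulmx mulmxA (mulmx1C hQ) mul1mx.
have -> : dot (block z k) (block z k) - dot (block zdes k) (block zdes k) =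
    dot (block z k - w) (block z k + w).
  by rewrite -ww dotBl !dotDr (dotC w); ring.
have hzk : enorm (block z k - w) <= r.
  by rewrite -blockB (le_trans (enorm_block_le _ _)).
rewrite (le_trans (abs_dot_le _ _)) // mulrC ler_pM ?enorm_ge0 //.
have -> : block z k + w = (block z k - w) + 2 *: w.
  by rewrite scaler_nat mulr2n addrA subrK.
rewrite (le_trans (ler_enormD _ _)) // addrC lerD ?(le_trans hzk) //.
rewrite enormZ ger0_norm // ler_wpM2l // -(enorm_rotate_des hQ).
exact: enorm_block_le.
Qed.

Lemma err_le_feedback x y :
  enorm (err x - err y) <= 2 * enorm (feedback mu x - feedback mu y).
Proof.
have s2_gt0 : 0 < Num.sqrt 2 :> R by rewrite sqrtr_gt0.
have s2_le2 : Num.sqrt 2 <= 2 :> R.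
  have s4 : Num.sqrt (2 ^+ 2) = 2 :> R by rewrite sqrtr_sqr ger0_norm.
  by rewrite -[leRHS]s4 ler_sqrt ?exprn_ge0 // -natrX ler_nat.
rewrite /feedback opp_col_mx add_col_mx -scalerBr.
apply: le_trans (_ : 2 * enorm ((Num.sqrt 2)^-1 *: (err x - err y)) <= _); last first.
  by rewrite ler_wpM2l // enorm_le_col_mxu.
rewrite enormZ ger0_norm ?invr_ge0 ?(ltW s2_gt0) // mulrA.
by rewrite ler_peMl ?enorm_ge0 // ler_pdivlMr // mul1r.
Qed.

Lemma est_le_feedback x y :
  enorm (est x - est y) <= enorm (feedback mu x - feedback mu y).
Proof.
rewrite /feedback opp_col_mx add_col_mx.
apply: le_trans (enorm_le_col_mxd _ _).
by rewrite opprB [in leRHS]addrC addrA subrK enormB.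
Qed.

(** Among consistent states this vanishes exactly at the equilibria; near the
  desired shape it bounds the distance that the formation has still to move. *)
Definition activity x : R := enorm (vel x) + enorm (force G mu x).

Theorem formation_trapping : exists C c r : R, [/\ 0 < C, 0 < c, 0 < r <= 1 &
  forall T (x : R -> state R m n ne) Q r', (0 < T)%E -> solution G zdes mu T x ->
  Q *m Q^T = 1%:M -> r' <= r -> near_copy r' Q (x 0) ->
  activity (x 0) <= C * r' /\
  forall s t, 0 <= s -> s <= t -> (t%:E < T)%E ->
    sdist (x t) (x s) <= C * activity (x 0) * expR (- c * s)].
Proof.
have [C0 [rho0 [C0p rho0p tr]]] := transverse_desired hn hrigid hne.
have [C1 [c [delta [C1p cp deltap trap]]]] := exponential_trapping
  (@gain R m n ne G) (kron_id m (incidence R G))^T C0p rho0p (enorm_ge0 zdes).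
have [KA KA0 hA] := bilinear_bounded (@gain R m n ne G).
have [KT KT0 hT] := adjoint_bounded (@gain R m n ne G).
have [KB KB0 hB] := mulmx_bounded (kron_id m (incidence R G))^T.
set Z := enorm zdes in trap *.
have Z0 : 0 <= Z := enorm_ge0 _.
pose E := ne%:R * (2 * Z + 1) + 1.
have E1 : 1 <= E by rewrite /E lerDr mulr_ge0 // addr_ge0 // mulr_ge0.
pose P := 1 + KA * (Z + 1) * E.
have P1 : 1 <= P by rewrite /P lerDl !mulr_ge0 ?(ltW KA0) //; lra.
pose r := Num.min 1 (delta / E).
have rp : 0 < r by rewrite lt_min ltr01 divr_gt0 //; lra.
have r1 : r <= 1 by rewrite ge_min lexx.
have Er : E * r <= delta by rewrite mulrC -ler_pdivlMr ?ge_min ?lexx ?orbT //; lra.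
pose S := C1 / c.
have Sp : 0 < S by rewrite divr_gt0.
pose Zm := Z + 1 + KB * S * P.
have Zm0 : 0 <= Zm.
  have P0 : 0 <= P by lra.
  have : 0 <= KB * S * P by rewrite mulr_ge0 // mulr_ge0 // ltW.
  by rewrite /Zm; lra.
pose C := P + (S + 2 * C1 + KB * S + 3 * (KT * Zm * S)).
have KBS : 0 <= KB * S by rewrite mulr_ge0 // ltW.
have KTS : 0 <= KT * Zm * S by rewrite mulr_ge0 ?(ltW Sp) // mulr_ge0 // ltW.
have CP : P <= C by rewrite /C; lra.
have C2 : S + 2 * C1 + KB * S + 3 * (KT * Zm * S) <= C by rewrite /C; lra.
exists C, c, r; split; [by lra|by []|by rewrite rp|].
move=> T x Q r' T0 sol hQ rr' [hz hv he].
have fl := solution_flow sol.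
have r'0 : 0 <= r' by apply: le_trans hv; exact: enorm_ge0.
have Er' : E * r' <= delta by apply: le_trans Er; rewrite ler_wpM2l //; lra.
have hv' : enorm (vel (x 0)) <= delta.
  by apply: le_trans hv _; apply: le_trans Er'; rewrite ler_peMl.
have hz' : enorm (rpos (x 0) - rotate Q zdes) <= delta.
  by apply: le_trans hz _; apply: le_trans Er'; rewrite ler_peMl.
have hg : enorm (feedback mu (x 0)) <= E * r'.
  have [cons0 _] := sol 0 (lexx 0) T0.
  have := error_small hQ cons0 (le_trans rr' r1) hz; rewrite -/Z => herr.
  rewrite (le_trans (col_mx_le_enorm _ _)) // /E mulrDl mul1r lerD //.
    apply: le_trans herr; rewrite enormZ ler_piMl ?enorm_ge0 //.
    rewrite ger0_norm ?invr_ge0 // invf_le1 ?sqrtr_gt0 //.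
    by rewrite -[1 in leLHS]sqrtr1 ler_sqrt // ler1n.
  by rewrite enormB.
have z00 : enorm (rpos (x 0)) <= Z + 1.
  rewrite -(subrK (rotate Q zdes) (rpos (x 0))) (le_trans (ler_enormD _ _)) //.
  by rewrite addrC enorm_rotate_des // lerD // (le_trans hz) // (le_trans rr').
have hN : activity (x 0) <= P * r'.
  rewrite /P mulrDl mul1r lerD // (le_trans (hA _ _)) //.
  rewrite -[leRHS]mulrA ler_pM ?mulr_ge0 ?enorm_ge0 ?(ltW KA0) //.
  by rewrite ler_wpM2l // ltW.
have N00 : 0 <= activity (x 0) by rewrite addr_ge0 ?enorm_ge0.
set N0 := activity (x 0) in hN N00 *.
split; first by apply: le_trans hN _; rewrite ler_wpM2r.
have zQ : enorm (rotate Q zdes) <= Z by rewrite enorm_rotate_des.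
have dec t : 0 <= t -> (t%:E < T)%E -> enorm (vel (x t)) <= C1 * N0 * expR (- c * t).
  move=> t0 tT; have [] // := trap _ zQ (tr Q hQ) T (fun t => vel (x t))
    (fun t => rpos (x t)) (fun t => feedback mu (x t)) fl hz' (le_trans hg Er') hv' t t0 tT.
have drift k (f : R -> 'cV[R]_k) (d : R -> 'cV[R]_k) K : 0 <= K ->
    (forall t, 0 <= t -> (t%:E < T)%E -> vderive f t (d t)) ->
    (forall t, 0 <= t -> (t%:E < T)%E -> enorm (d t) <= K * enorm (vel (x t))) ->
    forall s t, 0 <= s -> s <= t -> (t%:E < T)%E ->
    enorm (f t - f s) <= K * S * N0 * expR (- c * s).
  move=> K0 hf hd s t s0 st tT.
  have inT q : 0 <= q <= t -> 0 <= q /\ (q%:E < T)%E.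
    by move=> /andP[q0 qt]; split=> //; apply: le_lt_trans tT; rewrite lee_fin.
  rewrite (_ : K * S * N0 = (K * (C1 * N0)) / c); last by rewrite /S; ring.
  apply: (@exponential_drift _ _ f d c _ t) => //.
  - by rewrite !mulr_ge0 // ltW.
  - by move=> q /inT[q0 qT]; exact: hf.
  - move=> q /inT[q0 qT]; apply: le_trans (hd q q0 qT) _.
    by rewrite -mulrA ler_wpM2l // dec.
have dz : forall s t, 0 <= s -> s <= t -> (t%:E < T)%E ->
    enorm (rpos (x t) - rpos (x s)) <= KB * S * N0 * expR (- c * s).
  apply: (drift _ (fun t => rpos (x t))
    (fun t => (kron_id m (incidence R G))^T *m vel (x t))) => [|t t0 tT|t _ _].
  - by rewrite ltW.
  - by have [] := fl t t0 tT.
  - exact: hB.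
have dp : forall s t, 0 <= s -> s <= t -> (t%:E < T)%E ->
    enorm (pos (x t) - pos (x s)) <= 1 * S * N0 * expR (- c * s).
  apply: (drift _ (fun t => pos (x t)) (fun t => vel (x t))) => // [t t0 tT|t _ _].
    by have [_ [/is_derive_vderive]] := sol t t0 tT.
  by rewrite mul1r.
have zZm t : 0 <= t -> (t%:E < T)%E -> enorm (rpos (x t)) <= Zm.
  move=> t0 tT; rewrite -(subrK (rpos (x 0)) (rpos (x t))).
  rewrite (le_trans (ler_enormD _ _)) // addrC lerD //.
  apply: le_trans (dz 0 t (lexx 0) t0 tT) _; rewrite mulr0 expR0 mulr1.
  by rewrite ler_wpM2l // (le_trans hN) // ler_piMr ?(le_trans rr') //; lra.
have dg : forall s t, 0 <= s -> s <= t -> (t%:E < T)%E ->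
    enorm (feedback mu (x t) - feedback mu (x s)) <= KT * Zm * S * N0 * expR (- c * s).
  apply: (drift _ (fun t => feedback mu (x t))
    (fun t => (gain G (rpos (x t)))^T *m vel (x t))) => [|t t0 tT|t t0 tT].
  - by rewrite mulr_ge0 // ltW.
  - by have [] := fl t t0 tT.
  apply: le_trans (hT _ _) _.
  by rewrite ler_wpM2r ?enorm_ge0 // ler_wpM2l ?(ltW KT0) //; exact: zZm.
move=> s t s0 st tT; have sT : (s%:E < T)%E by apply: le_lt_trans tT; rewrite lee_fin.
have e0 := expR_ge0 (- c * s).
have dv : enorm (vel (x t) - vel (x s)) <= 2 * C1 * N0 * expR (- c * s).
  have hs := dec s s0 sT; have ht := dec t (le_trans s0 st) tT.
  have : C1 * N0 * expR (- c * t) <= C1 * N0 * expR (- c * s).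
    rewrite ler_wpM2l ?mulr_ge0 ?(ltW C1p) // ler_expR !mulNr lerN2.
    by rewrite ler_wpM2l // ltW.
  by have := ler_enormB (vel (x t)) (vel (x s)); lra.
have hg' := dg s t s0 st tT.
have hz1 := dz s t s0 st tT; have hp1 := dp s t s0 st tT.
apply: le_trans (sdist_le_sum _ _) _.
have h1 := err_le_feedback (x t) (x s); have h2 := est_le_feedback (x t) (x s).
apply: (@le_trans _ _ ((S + 2 * C1 + KB * S + 3 * (KT * Zm * S)) * N0 * expR (- c * s))).
  move: hg' hz1 hp1 dv h1 h2; rewrite mul1r.
  set e := expR _; lra.
by rewrite ler_wpM2r // ler_wpM2r.
Qed.

End Trapping.

Section Consequences.
Variables (R : realType) (m n ne : nat) (G : sensing_graph n ne).
Variables (zdes : 'cV[R]_(ne * m)) (mu : 'cV[R]_ne).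
Implicit Types (x y : state R m n ne).

Lemma sdist_weak_triangle x y w : sdist x y <= 5 * (sdist x w + sdist w y).
Proof.
apply: le_trans (sdist_le_sum _ _) _.
have t k (a b c : 'cV[R]_k) D : enorm (a - c) + enorm (c - b) <= D -> enorm (a - b) <= D.
  by apply: le_trans; exact: ler_enorm_dist.
have hp : enorm (pos x - pos y) <= sdist x w + sdist w y.
  by apply: (t _ _ _ (pos w)); rewrite lerD ?pos_le_sdist.
have hv : enorm (vel x - vel y) <= sdist x w + sdist w y.
  by apply: (t _ _ _ (vel w)); rewrite lerD ?vel_le_sdist.
have hz : enorm (rpos x - rpos y) <= sdist x w + sdist w y.
  by apply: (t _ _ _ (rpos w)); rewrite lerD ?rpos_le_sdist.
have he : enorm (err x - err y) <= sdist x w + sdist w y.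
  by apply: (t _ _ _ (err w)); rewrite lerD ?err_le_sdist.
have hm : enorm (est x - est y) <= sdist x w + sdist w y.
  by apply: (t _ _ _ (est w)); rewrite lerD ?est_le_sdist.
lra.
Qed.

Lemma activity_lipschitz y : equilibrium G zdes mu y -> exists2 K, 0 < K &
  forall x, sdist x y <= 1 -> activity G mu x <= K * sdist x y.
Proof.
move=> /equilibriumP[_ v0 F0].
have [KA KA0 hA] := bilinear_bounded (@gain R m n ne G).
exists (1 + KA * (enorm (feedback mu y) + 2 + 2 * enorm (rpos y))).
  by rewrite ltr_pwDl // mulr_ge0 ?(ltW KA0) // !addr_ge0 ?mulr_ge0 ?enorm_ge0.
move=> x xy; set s := sdist x y in xy *; have s0 : 0 <= s := sdist_ge0 _ _.
rewrite /activity mulrDl mul1r lerD //.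
  by rewrite -[vel x]subr0 -v0 vel_le_sdist.
have gE : enorm (feedback mu x - feedback mu y) <= 2 * s := feedback_lipschitz _ _ _.
have gx : enorm (feedback mu x) <= enorm (feedback mu y) + 2.
  rewrite -(subrK (feedback mu y) (feedback mu x)) (le_trans (ler_enormD _ _)) //.
  by rewrite addrC lerD2l (le_trans gE) //; lra.
have -> : force G mu x = gain G (rpos x - rpos y) *m feedback mu x
    + gain G (rpos y) *m (feedback mu x - feedback mu y).
  rewrite mulmxBr -/(force G mu y) F0 subr0 -mulmxDl.
  by rewrite -linearD /= subrK.
apply: le_trans (ler_enormD _ _) _.
have h1 : enorm (gain G (rpos x - rpos y) *m feedback mu x) <=
    KA * s * (enorm (feedback mu y) + 2).
  apply: le_trans (hA _ _) _; rewrite ler_pM ?mulr_ge0 ?enorm_ge0 ?(ltW KA0) //.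
  by rewrite ler_wpM2l ?(ltW KA0) // rpos_le_sdist.
have h2 : enorm (gain G (rpos y) *m (feedback mu x - feedback mu y)) <=
    KA * enorm (rpos y) * (2 * s).
  by apply: le_trans (hA _ _) _; rewrite ler_wpM2l // mulr_ge0 ?enorm_ge0 // ltW.
apply: le_trans (lerD h1 h2) _.
by rewrite le_eqVlt; apply/orP; left; apply/eqP; ring.
Qed.

Lemma exponential_converges (x : R -> state R m n ne) c K : 0 < c ->
  (forall s t, 0 <= s -> s <= t -> sdist (x t) (x s) <= K * expR (- c * s)) ->
  exists y, converges x y.
Proof.
move=> c0 h.
have lim k (f : state R m n ne -> 'cV[R]_k) :
    (forall x y, enorm (f x - f y) <= sdist x y) ->
    exists l, forall t, 0 <= t -> enorm (f (x t) - l) <= k%:R * K * expR (- c * t).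
  move=> hf; apply: (exponential_limit (x := fun t => f (x t))) => s t s0 st.
  by apply: le_trans (hf _ _) _; exact: h.
have [p hp] := lim _ _ (@pos_le_sdist R m n ne).
have [v hv] := lim _ _ (@vel_le_sdist R m n ne).
have [z hz] := lim _ _ (@rpos_le_sdist R m n ne).
have [e he] := lim _ _ (@err_le_sdist R m n ne).
have [q hq] := lim _ _ (@est_le_sdist R m n ne).
exists (State p v z e q); apply: (exponential_cvg0 (c := c)
  (C := (n * m)%:R * K + (n * m)%:R * K + (ne * m)%:R * K + ne%:R * K + ne%:R * K)) => //.
move=> t t0; rewrite ger0_norm ?sdist_ge0 // (le_trans (sdist_le_sum _ _)) //.
by rewrite !mulrDl !lerD //=; [exact: hp | exact: hv | exact: hz | exact: he | exact: hq].
Qed.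

End Consequences.

(** The force of an equilibrium is zero, so invertibility of the gain leaves
  neither error nor mismatch, and equal edge lengths near the desired shape
  give the shape itself. *)
Theorem simplex_equilibrium (R : realType) m n ne (G : sensing_graph n ne)
    (pdes : 'cV[R]_(n * m)) (mu : 'cV[R]_ne) :
  (2 <= n)%N -> inf_min_rigid G pdes -> triangle m G \/ tetrahedron m G ->
  let zdes := relpos G pdes in
  exists2 rho : R, 0 < rho & forall y Q, equilibrium G zdes mu y -> rotation Q ->
  enorm (rpos y - rotate Q zdes) <= rho ->
  [/\ err y = 0, est y = mu & desired_shape zdes (rpos y)].
Proof.
move=> hn hrigid tt zdes.
have [rho1 rho1p inj] := injective_desired hn hrigid tt.
have [rho2 rho2p congr] : exists2 rho : R, 0 < rho & forall p (Q : 'M[R]_m), rotation Q ->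
    enorm (relpos G p - rotate Q zdes) <= rho ->
    (forall k, enorm (block (relpos G p) k) = enorm (block zdes k)) ->
    desired_shape zdes (relpos G p).
  have span : (m < n)%N -> forall i (u : 'cV[R]_m),
      (forall k, incident G i k -> dot (block zdes k) u = 0) -> u = 0.
    by move=> mn i u; exact: rigid_span.
  have [En cG] : n = m.+1 /\ complete_graph G by case: tt => -[Em En cG]; split=> //; rewrite En Em.
  clear - En cG span; subst n.
  by apply: congruent_near cG _ _ => u; exact: span.
exists (Num.min rho1 rho2); first by rewrite lt_min rho1p.
move=> y Q /equilibriumP[[hz he] _ F0] hQ; rewrite le_min => /andP[h1 h2].
have [hQQ _] := hQ.
have := inj Q hQQ _ h1 _ F0; rewrite /feedback -col_mx0 => /eq_col_mx[e0 m0].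
have ey : err y = 0.
  by move/eqP: e0; rewrite scaler_eq0 invr_eq0 gt_eqF ?sqrtr_gt0 //= => /eqP.
split=> //; first by apply/eqP; rewrite eq_sym -subr_eq0; apply/eqP.
rewrite hz; apply: congr hQ _ _; rewrite -hz // => k.
have := congr1 (fun M : 'cV_ne => M k 0) he; rewrite ey errorE mxE => /esym/eqP.
by rewrite subr_eq0 => /eqP h; rewrite !enormE h.
Qed.

Theorem mainTheorem2 (R : realType) (m n ne : nat)
    (hm : m = 2%N \/ m = 3%N) (hn : (2 <= n)%N)
    (G : sensing_graph n ne) (pdes : 'cV[R]_(n * m))
    (hrigid : inf_min_rigid G pdes)
    (mu : 'cV[R]_ne) (hmu : mu != 0) :
  let zdes := relpos G pdes in
  exists2 r : R, 0 < r &
  [/\ forall y : state R m n ne,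
        equilibrium G zdes mu y -> near_desired zdes mu r y ->
        vel y = 0 /\ asymptotically_stable G zdes mu y,
      forall x : R -> state R m n ne,
        solution G zdes mu +oo%E x -> near_desired zdes mu r (x 0) ->
        exists2 y, equilibrium G zdes mu y & converges x y,
      forall (x : R -> state R m n ne) (y : state R m n ne),
        solution G zdes mu +oo%E x -> converges x y ->
        [/\ equilibrium G zdes mu y,
            vel y = 0 &
            enorm (err y) ^+ 2 <=
              2 * enorm (mu - est (x 0)) ^+ 2 + 2 * enorm (vel (x 0)) ^+ 2
              + enorm (err (x 0)) ^+ 2] &
      triangle m G \/ tetrahedron m G ->
        (forall y : state R m n ne,
           equilibrium G zdes mu y -> near_desired zdes mu r y ->
           [/\ err y = 0, est y = mu & desired_shape zdes (rpos y)]) /\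
        (forall (x : R -> state R m n ne) (y : state R m n ne),
           solution G zdes mu +oo%E x -> near_desired zdes mu r (x 0) ->
           converges x y ->
           [/\ err y = 0, est y = mu & desired_shape zdes (rpos y)])].
Proof.
move=> zdes.
have ne0 : (0 < ne)%N.
  rewrite lt0n; apply: contra hmu => /eqP E; apply/eqP/colP => -[i hi].
  by exfalso; rewrite E in hi.
have [C [c [r0 [Cp cp /andP[r0p r01] trap]]]] := formation_trapping mu hn hrigid ne0.
have [rho rhop simplex_eq] : exists2 rho : R, 0 < rho &
    triangle m G \/ tetrahedron m G -> forall y Q, equilibrium G zdes mu y ->
    rotation Q -> enorm (rpos y - rotate Q zdes) <= rho ->
    [/\ err y = 0, est y = mu & desired_shape zdes (rpos y)].
  have [tt|ntt] := pselect (triangle m G \/ tetrahedron m G); last by exists 1.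
  by have [rho rhop h] := simplex_equilibrium mu hn hrigid tt; exists rho.
(* The first bound keeps solutions that start near an equilibrium in the
   trapping region, the second keeps their limits so close to the desired shape
   that simplex_equilibrium applies. *)
pose r := Num.min (r0 / 2) (rho / (2 + C * C)).
have CC : 0 < C * C by rewrite mulr_gt0.
have rp : 0 < r by rewrite lt_min !divr_gt0 //; lra.
have rr0 : r <= r0 / 2 by rewrite ge_min lexx.
have rrho : (2 + C * C) * r <= rho.
  by rewrite mulrC -ler_pdivlMr ?ge_min ?lexx ?orbT //; lra.
have near_sol x y Q : near_copy G pdes mu r Q y -> sdist x y <= r0 / 2 ->
    near_copy G pdes mu r0 Q x.
  move=> [hz hv he] xy; split.
  - apply: le_trans (ler_enorm_dist _ _ (rpos y)) _.
    by have := rpos_le_sdist x y; lra.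
  - rewrite -(subrK (vel y) (vel x)) (le_trans (ler_enormD _ _)) //.
    by have := vel_le_sdist x y; lra.
  - apply: le_trans (ler_enorm_dist _ _ (est y)) _.
    by have := est_le_sdist x y; lra.
have settles (x : R -> state R m n ne) Q : solution G zdes mu +oo%E x ->
    Q *m Q^T = 1%:M -> near_copy G pdes mu r0 Q (x 0) ->
    exists2 y, equilibrium G zdes mu y & converges x y.
  move=> sol hQ hx; have [_ dist] := trap _ _ _ _ (ltry 0) sol hQ (lexx r0) hx.
  have [s t s0 st|y cy] := exponential_converges (x := x) cp (K := C * activity G mu (x 0)).
    exact: dist (ltry t).
  by exists y => //; exact: limit_equilibrium sol cy.
exists r => //; split.
- move=> y heq /near_desired_copy[Q [hQ _] hy].
  have [_ v0 _] := (equilibriumP _ _ _ _).1 heq; split=> //; split=> //.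
    move=> eps eps0; have [K K0 act] := activity_lipschitz heq.
    pose L := 5 * (C * K + 1).
    have L0 : 0 < L by rewrite mulr_gt0 // addr_gt0 // mulr_gt0.
    exists (Num.min (r0 / 2) (eps / L)); first by rewrite lt_min !divr_gt0.
    move=> T x sol; rewrite lt_min => /andP[/ltW d1 d2] t t0 tT.
    have T0 : (0 < T)%E by apply: le_lt_trans tT; rewrite lee_fin.
    have [_ dist] := trap _ _ _ _ T0 sol hQ (lexx r0) (near_sol _ _ _ hy d1).
    have := dist 0 t (lexx 0) t0 tT; rewrite mulr0 expR0 mulr1 => hd.
    have ha : activity G mu (x 0) <= K * sdist (x 0) y by apply: act; lra.
    have hCa := ler_wpM2l (ltW Cp) ha.
    apply: le_lt_trans (sdist_weak_triangle _ _ (x 0)) _.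
    apply: (@le_lt_trans _ _ (L * sdist (x 0) y)); first by rewrite /L; lra.
    by rewrite mulrC -ltr_pdivlMr.
  exists (r0 / 2); first by rewrite divr_gt0.
  by move=> x sol /ltW d; apply: settles sol hQ (near_sol _ _ _ hy d).
- move=> x sol /near_desired_copy[Q [hQ _] [hz hv he]].
  by apply: settles sol hQ _; split; lra.
- move=> x y sol cy; have heq := limit_equilibrium sol cy.
  have [_ v0 _] := (equilibriumP _ _ _ _).1 heq.
  by split=> //; exact: energy_bound sol cy.
move=> tt; split.
  move=> y heq /near_desired_copy[Q hQ [hz _ _]].
  apply: (simplex_eq tt y Q) => //; apply: le_trans hz _; apply: le_trans rrho.
  by rewrite ler_peMl ?(ltW rp) //; lra.
move=> x y sol /near_desired_copy[Q hQ hx] cy; have [hQQ _] := hQ.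
apply: (simplex_eq tt y Q) => //; first exact: limit_equilibrium sol cy.
have rr : r <= r0 by lra.
have [act dist] := trap _ _ _ _ (ltry 0) sol hQQ rr hx.
have [t t0 hty] : exists2 t : R, 0 <= t & sdist (x t) y < r.
  have /cvgr0Pnorm_lt/(_ _ rp)[M [_ hM]] := cy.
  exists (Num.max 0 M + 1); first by rewrite addr_ge0 // le_max lexx.
  have := hM (Num.max 0 M + 1); rewrite /= ger0_norm ?sdist_ge0 //; apply.
  by rewrite (le_lt_trans (_ : M <= Num.max 0 M)) ?le_max ?lexx ?orbT // ltrDl.
have := dist 0 t (lexx 0) t0 (ltry t); rewrite mulr0 expR0 mulr1 => hd.
have hCa := ler_wpM2l (ltW Cp) act.
have [hz _ _] := hx; apply: le_trans rrho.
apply: le_trans (ler_enorm_dist _ _ (rpos (x 0))) _.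
have h1 := ler_enorm_dist (rpos y) (rpos (x 0)) (rpos (x t)).
have h2 := rpos_le_sdist (x t) y; have h3 := rpos_le_sdist (x t) (x 0).
rewrite [enorm (rpos y - rpos (x t))]enormB in h1.
lra.
Qed.
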